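(* Let $n\geq 2$, let $\mathbb{K}$ be a field, $G=\mathrm{SL}(n+1,\mathbb{K})$, $A$ the adjoint $G$-module of traceless $(n+1)\times(n+1)$ matrices over $\mathbb{K}$, $\varepsilon_{\mathrm{nat}}:A_{n,\{1,n\}}(\mathbb{K})\to\mathrm{PG}(A)$ the natural embedding, $\widehat{\varepsilon}_{\mathrm{nat}}:A_{n,\{1,n\}}(\mathbb{K})\to\mathrm{PG}(\widehat{A})$ its relatively universal cover, and $M$ the kernel of the projection of $\widehat{\varepsilon}_{\mathrm{nat}}$ onto $\varepsilon_{\mathrm{nat}}$. As a $G$-module, $\widehat{A}$ is a non-split central extension $\widehat{A}=M\cdot A$ of $A$, and $M^*\cong H^1(A^*,G)$.
   Context: Geometry: $A_{n,\{1,n\}}(\mathbb{K})$ is the point-line geometry whose points are the flags $(p,H)$ with $p$ a point and $H$ a hyperplane of $\mathrm{PG}(n,\mathbb{K})$, $p\in H$; its lines are the sets $\ell_{p,S}=\{(p,X): X \text{ a hyperplane}, X\supset S\}$ ($S$ a subspace of codimension $2$, $p\in S$) and $\ell_{L,H}=\{(x,H): x\in L\}$ ($L$ a line contained in the hyperplane $H$). Embeddings: a projective embedding of a point-line geometry $\Gamma$ is an injective map $\varepsilon$ from the points of $\Gamma$ to the points of $\mathrm{PG}(V)$, $V$ a vector space, mapping every line of $\Gamma$ onto a line of $\mathrm{PG}(V)$ and with image spanning $\mathrm{PG}(V)$. An embedding $\varepsilon':\Gamma\to\mathrm{PG}(V')$ covers $\varepsilon$ if there is a semilinear map $\phi:V'\to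 V$ with $\varepsilon=\phi\circ\varepsilon'$; $\phi$ (unique up to rescaling) is the projection of $\varepsilon'$ onto $\varepsilon$ and $\ker\phi$ is the kernel of the projection. Every embedding $\varepsilon$ has a relatively universal cover $\widehat{\varepsilon}$, unique up to isomorphism, which covers every embedding covering $\varepsilon$. Natural embedding: $A$ is the space of $(n+1)\times(n+1)$ matrices of trace $0$ over $\mathbb{K}$, with right $G$-action $a\cdot g=g^{-1}ag$. If $p$ is represented by a non-zero row vector $v$ and $H$ by a non-zero linear functional $\alpha$ (a column vector), then $\varepsilon_{\mathrm{nat}}(p,H)$ is the point of $\mathrm{PG}(A)$ represented by the matrix $\alpha v$. The action of $G$ on the geometry lifts through $\widehat{\varepsilon}_{\mathrm{nat}}$ to a linear action on $\widehat{A}$ that stabilizes $M$ and induces on $\widehat{A}/M\cong A$ the given action; this makes $\widehat{A}$ a $G$-module. Extensions: a $G$-module $U$ with a submodule $W$ such that $U/W\cong V$ as $G$-modules is an extension of $V$ with kernel $W$, written $U=W\cdot V$. It is central if $G$ acts trivially on $W$. It is trivial if $W=\{0\}$. A non-trivial extension splits if there is an injective linear map $\phi:V\to U$ with $\phi(V)$ stabilized by $G$ and $\pi\circ\phi=\mathrm{id}_V$, $\pi:U\to U/W\cong V$ being the canonical projection; an extension that does not split (in particular a trivial one) is called non-split. Cohomology: the dual $V^*$ of a right $G$-module $V$ is a right $G$-module via $(\xi\cdot g)(x)=\xi(x\cdot g^{-1})$. $Z^1(V^*,G)$ is the space of maps $f:G\to V^*$ with $f(1)=0$ and $f(g_1g_2)=f(g_1)\cdot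 g_2+f(g_2)$; $B^1(V^*,G)$ is the subspace of the maps $g\mapsto\lambda\cdot g-\lambda$, $\lambda\in V^*$; $H^1(V^*,G)=Z^1(V^*,G)/B^1(V^*,G)$. The isomorphism $M^*\cong H^1(A^*,G)$ is one of $\mathbb{K}$-vector spaces. *)

(* Defs.v *)
From HB Require Import structures.
From mathcomp Require Import all_boot all_algebra generic_quotient ring_quotient.
From mathcomp Require Import boolp classical_sets functions.

Set Implicit Arguments.
Unset Strict Implicit.
Unset Printing Implicit Defensive.

Import GRing.Theory.
Local Open Scope classical_set_scope.
Local Open Scope ring_scope.

Section Kernel.
Variables (K : fieldType) (U V : lmodType K) (phi : {linear U -> V}).

Definition kerp : {pred U} := fun u => phi u == 0.

Fact kerp_submod_closed : submod_closed kerp.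
Proof.
split=> [|c u v]; rewrite !unfold_in ?linear0 // => /eqP u0 /eqP v0.
by rewrite linearP u0 v0 scaler0 addr0.
Qed.

HB.instance Definition _ := GRing.isSubmodClosed.Build K U kerp kerp_submod_closed.

Record kermod := Kermod { kermod_val :> U; _ : kermod_val \in kerp }.
HB.instance Definition _ := [isSub for kermod_val].
HB.instance Definition _ := [Choice of kermod by <:].
HB.instance Definition _ := [SubChoice_isSubLmodule of kermod by <:].

End Kernel.

Section Dual.
Variables (K : fieldType) (V : lmodType K).

Definition linear_form : {pred V -> K^o} := fun f => `[< linear f >].

Fact linear_form_submod_closed : submod_closed linear_form.
Proof.
split=> [|c f h]; rewrite !unfold_in.
  by apply/asboolP => a u v; rewrite /GRing.zero /= scaler0 addr0.
move=> /asboolP lf /asboolP lh; apply/asboolP => a u v.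
by rewrite !fctE lf lh !scalerDr !scalerA [a * c]mulrC addrACA.
Qed.

HB.instance Definition _ :=
  GRing.isSubmodClosed.Build K (V -> K^o) linear_form linear_form_submod_closed.

Record dual := Dual { dual_val :> V -> K^o; _ : dual_val \in linear_form }.
HB.instance Definition _ := [isSub for dual_val].
HB.instance Definition _ := [Choice of dual by <:].
HB.instance Definition _ := [SubChoice_isSubLmodule of dual by <:].

Lemma dual_linear (f : dual) : linear f.
Proof. by case: f => f /= /asboolP. Qed.

End Dual.

Section QuotientModule.
Local Open Scope quotient_scope.
Variables (K : fieldType) (V : lmodType K) (W : submodClosed V).

(* [submodClosed] carries no closure under opposites, which [Quotient.quot] needs. *)
Definition quot_pred : {pred V} := W.

Fact quot_pred_zmod_closed : zmod_closed quot_pred.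
Proof.
split=> [|u v uW vW]; first exact: (rpred0 W).
by rewrite -scaleN1r; apply: (rpredD (S := W)) => //; apply: (rpredZ (s := W)).
Qed.

HB.instance Definition _ :=
  GRing.isZmodClosed.Build V quot_pred quot_pred_zmod_closed.

Definition quotmod := Quotient.quot quot_pred.
HB.instance Definition _ := GRing.Zmodule.on quotmod.

Definition quotmod_scale (c : K) : quotmod -> quotmod :=
  fun x => \pi_quotmod (c *: repr x).

Lemma quotmod_scale_pi c v :
  quotmod_scale c (\pi_quotmod v) = \pi_quotmod (c *: v).
Proof.
apply/eqP; rewrite /quotmod_scale -Quotient.idealrBE -scalerBr.
apply: (rpredZ (s := W)).
change (repr (\pi_quotmod v) - v \in quot_pred).
by rewrite Quotient.idealrBE reprK.
Qed.

Fact quotmod_scaleA a b x :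
  quotmod_scale a (quotmod_scale b x) = quotmod_scale (a * b) x.
Proof.
elim/quotW: x => v.
by rewrite (quotmod_scale_pi b v) !quotmod_scale_pi scalerA.
Qed.

Fact quotmod_scale1 : left_id 1 quotmod_scale.
Proof. by elim/quotW => v; rewrite quotmod_scale_pi scale1r. Qed.

Fact quotmod_scaleDr : right_distributive quotmod_scale +%R.
Proof.
move=> c; elim/quotW => u; elim/quotW => v.
by rewrite -(raddfD (\pi_quotmod)) !quotmod_scale_pi -raddfD scalerDr.
Qed.

Fact quotmod_scaleDl x : {morph quotmod_scale^~ x : a b / a + b}.
Proof.
move=> a b; elim/quotW: x => v.
by rewrite !quotmod_scale_pi -raddfD scalerDl.
Qed.

HB.instance Definition _ := GRing.Zmodule_isLmodule.Build K quotmod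
  quotmod_scaleA quotmod_scale1 quotmod_scaleDr quotmod_scaleDl.

End QuotientModule.

Definition lmod_isomorphic (K : fieldType) (U V : lmodType K) : Prop :=
  exists f : {linear U -> V}, bijective f.

Record raction (G : groupType) (K : fieldType) (V : lmodType K) := RAction {
  ract :> V -> G -> V;
  ract_linear : forall g, linear (ract^~ g);
  ract1 : forall v, ract v 1%g = v;
  ractM : forall v g h, ract v (g * h)%g = ract (ract v g) h
}.

Section DualAction.
Variables (G : groupType) (K : fieldType) (V : lmodType K) (a : raction G V).

Fact dual_act_subproof (xi : dual V) (g : G) :
  (fun x => xi (a x g^-1%g)) \in @linear_form K V.
Proof. by apply/asboolP => c u v; rewrite ract_linear dual_linear. Qed.

Definition dual_act (xi : dual V) (g : G) : dual V :=
  Dual (dual_act_subproof xi g).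

Fact dual_act_linear g : linear (dual_act^~ g).
Proof. by move=> c xi eta; apply: val_inj. Qed.

Fact dual_act1 xi : dual_act xi 1%g = xi.
Proof. by apply: val_inj; apply: funext => x /=; rewrite invg1 ract1. Qed.

Fact dual_actM xi g h : dual_act xi (g * h)%g = dual_act (dual_act xi g) h.
Proof. by apply: val_inj; apply: funext => x /=; rewrite invgM ractM. Qed.

Definition dual_raction : raction G (dual V) :=
  RAction dual_act_linear dual_act1 dual_actM.

End DualAction.

Section Cohomology.
Variables (G : groupType) (K : fieldType) (V : lmodType K) (a : raction G V).

Definition cocycle : {pred G -> V} := fun f =>
  `[< f 1%g = 0 /\ forall g h, f (g * h)%g = a (f g) h + f h >].

Fact cocycle_submod_closed : submod_closed cocycle.
Proof.
have a0 g : a 0 g = 0.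
  by have := ract_linear a g (-1) 0 0; rewrite scaler0 addr0 scaleN1r addNr.
split=> [|c f h]; rewrite !unfold_in.
  by apply/asboolP; split=> // g h; rewrite /GRing.zero /= a0 addr0.
move=> /asboolP[f1 fM] /asboolP[h1 hM]; apply/asboolP.
split=> [|x y]; rewrite !fctE ?f1 ?h1 ?scaler0 ?addr0 //.
by rewrite fM hM ract_linear scalerDr addrACA.
Qed.

HB.instance Definition _ :=
  GRing.isSubmodClosed.Build K (G -> V) cocycle cocycle_submod_closed.

Record Z1 := MkZ1 { Z1_val :> G -> V; _ : Z1_val \in cocycle }.
HB.instance Definition _ := [isSub for Z1_val].
HB.instance Definition _ := [Choice of Z1 by <:].
HB.instance Definition _ := [SubChoice_isSubLmodule of Z1 by <:].

Definition B1 : {pred Z1} := fun f =>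
  `[< exists lambda : V, forall g, f g = a lambda g - lambda >].

Fact B1_submod_closed : submod_closed B1.
Proof.
have a0 g : a 0 g = 0.
  by have := ract_linear a g (-1) 0 0; rewrite scaler0 addr0 scaleN1r addNr.
split=> [|c f h]; rewrite !unfold_in.
  by apply/asboolP; exists 0 => g; rewrite a0 subr0.
move=> /asboolP[l fl] /asboolP[m hm]; apply/asboolP.
exists (c *: l + m) => g.
rewrite ract_linear opprD addrACA -scalerBr -fl -hm.
by [].
Qed.

HB.instance Definition _ := GRing.isSubmodClosed.Build K Z1 B1 B1_submod_closed.

Definition H1 : lmodType K := quotmod B1.

End Cohomology.

Section Extension.
Variables (G : groupType) (K : fieldType) (U V : lmodType K).
Variables (aU : raction G U) (aV : raction G V).

(* [pi] is the composite of the projection U -> U/W with U/W ~ V. *)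
Definition is_extension (W : {pred U}) (pi : {linear U -> V}) : Prop :=
  [/\ submod_closed W,
      forall u g, u \in W -> aU u g \in W,
      forall v, exists u, pi u = v,
      forall u, (pi u == 0) = (u \in W)
    & forall u g, pi (aU u g) = aV (pi u) g].

Definition central (W : {pred U}) : Prop :=
  forall u g, u \in W -> aU u g = u.

(* By convention, trivial extensions (W = 0) do not split. *)
Definition splits (W : {pred U}) (pi : {linear U -> V}) : Prop :=
  (exists2 w, w \in W & w != 0) /\
  exists s : {linear V -> U},
    [/\ injective s, forall v g, exists v', aU (s v) g = s v' & cancel s pi].

Definition non_split W pi : Prop := ~ splits W pi.

End Extension.

Record geometry := Geometry {
  gpoint :> Type;
  gline : set (set gpoint)
}.

Section ProjectiveSpace.
Variables (F : fieldType) (V : lmodType F).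

(* Points of PG(V) are encoded as 1-dimensional subspaces, i.e. sets of vectors
   containing 0. *)
Definition pg_point (P : set V) : Prop :=
  exists2 v : V, v != 0 & P = [set x | exists c : F, x = c *: v].

Definition pg_line (l : set (set V)) : Prop :=
  exists v w : V,
    (forall a b : F, a *: v + b *: w = 0 -> a = 0 /\ b = 0) /\
    l = [set P | pg_point P /\
                 P `<=` [set x | exists a b : F, x = a *: v + b *: w]].

End ProjectiveSpace.

Definition is_embedding (Gamma : geometry) (F : fieldType) (V : lmodType F)
    (e : Gamma -> set V) : Prop :=
  [/\ forall x, pg_point (e x),
      injective e,
      forall l, gline l -> pg_line (e @` l)
    & forall U : {pred V}, submod_closed U ->
        (forall x v, e x v -> v \in U) -> forall v, v \in U].

Definition semilinear (F' F : fieldType) (V' : lmodType F') (V : lmodType F)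
    (sigma : {rmorphism F' -> F}) (phi : V' -> V) : Prop :=
  bijective sigma /\
  forall c u v, phi (c *: u + v) = sigma c *: phi u + phi v.

Definition projects (Gamma : Type) (V' V : Type) (phi : V' -> V)
    (e' : Gamma -> set V') (e : Gamma -> set V) : Prop :=
  forall x, phi @` e' x = e x.

Definition covers (Gamma : geometry) (F' F : fieldType)
    (V' : lmodType F') (V : lmodType F)
    (e' : Gamma -> set V') (e : Gamma -> set V) : Prop :=
  exists (sigma : {rmorphism F' -> F}) (phi : V' -> V),
    semilinear sigma phi /\ projects phi e' e.

Definition relatively_universal_cover (Gamma : geometry) (F' F : fieldType)
    (V' : lmodType F') (V : lmodType F)
    (e' : Gamma -> set V') (e : Gamma -> set V) : Prop :=
  [/\ is_embedding e',
      covers e' e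
    & forall (F'' : fieldType) (V'' : lmodType F'') (e'' : Gamma -> set V''),
        is_embedding e'' -> covers e'' e -> covers e' e''].

Section SpecialLinear.
Variables (n : nat) (K : fieldType).

Record SL := MkSL { SL_val :> 'M[K]_n.+1; _ : \det SL_val == 1 }.
HB.instance Definition _ := [isSub for SL_val].
HB.instance Definition _ := [Choice of SL by <:].

Lemma SL_det (g : SL) : \det g = 1.
Proof. by case: g => g /= /eqP. Qed.

Lemma SL_unit (g : SL) : (g : 'M_n.+1) \in unitmx.
Proof. by rewrite unitmxE SL_det unitr1. Qed.

Fact SL_one_subproof : \det (1%:M : 'M[K]_n.+1) == 1.
Proof. by rewrite det1. Qed.
Fact SL_mul_subproof (g h : SL) : \det (g *m h) == 1.
Proof. by rewrite det_mulmx !SL_det mulr1. Qed.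
Fact SL_inv_subproof (g : SL) : \det (invmx g) == 1.
Proof. by rewrite det_inv SL_det invr1. Qed.

Definition SL_one := MkSL SL_one_subproof.
Definition SL_mul g h := MkSL (SL_mul_subproof g h).
Definition SL_inv g := MkSL (SL_inv_subproof g).

Fact SL_mulA : associative SL_mul.
Proof. by move=> x y z; apply: val_inj; rewrite /= mulmxA. Qed.
Fact SL_mul1 : left_id SL_one SL_mul.
Proof. by move=> x; apply: val_inj; rewrite /= mul1mx. Qed.
Fact SL_mulr1 : right_id SL_one SL_mul.
Proof. by move=> x; apply: val_inj; rewrite /= mulmx1. Qed.
Fact SL_mulV : left_inverse SL_one SL_inv SL_mul.
Proof. by move=> x; apply: val_inj; rewrite /= mulVmx ?SL_unit. Qed.
Fact SL_mulrV : right_inverse SL_one SL_inv SL_mul.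
Proof. by move=> x; apply: val_inj; rewrite /= mulmxV ?SL_unit. Qed.

HB.instance Definition _ :=
  isGroup.Build SL SL_mulA SL_mul1 SL_mulr1 SL_mulV SL_mulrV.

Definition traceless : {pred 'M[K]_n.+1} := fun a => \tr a == 0.

Fact traceless_submod_closed : submod_closed traceless.
Proof.
split=> [|c a b]; rewrite !unfold_in ?mxtrace0 // => /eqP a0 /eqP b0.
by rewrite mxtraceD mxtraceZ a0 b0 mulr0 addr0.
Qed.

HB.instance Definition _ :=
  GRing.isSubmodClosed.Build K 'M[K]_n.+1 traceless traceless_submod_closed.

Record adjoint := Adjoint { adj_val :> 'M[K]_n.+1; _ : adj_val \in traceless }.
HB.instance Definition _ := [isSub for adj_val].
HB.instance Definition _ := [Choice of adjoint by <:].
HB.instance Definition _ := [SubChoice_isSubLmodule of adjoint by <:].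

Fact adj_act_subproof (a : adjoint) (g : SL) :
  invmx g *m a *m g \in traceless.
Proof.
by rewrite unfold_in -mulmxA mxtrace_mulC -mulmxA mulmxV ?SL_unit // mulmx1
           -[_ == 0]/(adj_val a \in traceless); case: a.
Qed.

Definition adj_act (a : adjoint) (g : SL) := Adjoint (adj_act_subproof a g).

Fact adj_act_linear g : linear (adj_act^~ g).
Proof.
move=> c a b; apply: val_inj => /=.
by rewrite mulmxDr mulmxDl -scalemxAr -scalemxAl.
Qed.

Fact adj_act1 a : adj_act a 1%g = a.
Proof. by apply: val_inj; rewrite /= invmx1 mul1mx mulmx1. Qed.

Fact adj_actM a g h : adj_act a (g * h)%g = adj_act (adj_act a g) h.
Proof.
apply: val_inj; rewrite /= -[invmx (g *m h)]/(SL_val (g * h)^-1%g) invgM /=.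
by rewrite !mulmxA.
Qed.

Definition adj_raction : raction SL adjoint :=
  RAction adj_act_linear adj_act1 adj_actM.

End SpecialLinear.

Section FlagGeometry.
Variables (n : nat) (K : fieldType).
Local Notation sub := {vspace 'rV[K]_n.+1}.

Record flag := Flag {
  flag_pt : sub;
  flag_hyp : sub;
  flag_dim_pt : \dim flag_pt = 1%N;
  flag_dim_hyp : \dim flag_hyp = n;
  flag_incident : (flag_pt <= flag_hyp)%VS
}.

Definition line_pS (p S : sub) : set flag :=
  [set x | flag_pt x = p /\ (S <= flag_hyp x)%VS].

Definition line_LH (L H : sub) : set flag :=
  [set x | (flag_pt x <= L)%VS /\ flag_hyp x = H].

Definition flag_line (l : set flag) : Prop :=
  (exists p S : sub, [/\ \dim p = 1%N, (\dim S + 2 = n.+1)%N, (p <= S)%VS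
                       & l = line_pS p S]) \/
  (exists L H : sub, [/\ \dim L = 2%N, \dim H = n, (L <= H)%VS
                       & l = line_LH L H]).

Definition flag_geometry : geometry := Geometry flag_line.

Definition sub_act (g : SL n K) (U : sub) : sub :=
  (linfun (mulmxr (g : 'M[K]_n.+1)) @: U)%VS.

Fact sub_act_dim g U : \dim (sub_act g U) = \dim U.
Proof.
apply/limg_dim_eq/eqP; rewrite -subv0.
apply/subvP => v /memv_capP[_]; rewrite memv_ker lfunE /= => /eqP vg0.
by rewrite memv0 -[v](mulmxK (SL_unit g)) vg0 mul0mx.
Qed.

Definition flag_act (x : flag) (g : SL n K) : flag :=
  @Flag (sub_act g (flag_pt x)) (sub_act g (flag_hyp x))
        (etrans (sub_act_dim g _) (flag_dim_pt x))
        (etrans (sub_act_dim g _) (flag_dim_hyp x))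
        (limgS _ (flag_incident x)).

(* The span of alpha v, where v spans p and alpha is a functional with kernel H. *)
Definition nat_embedding (x : flag_geometry) : set (adjoint n K) :=
  [set a | exists (v : 'rV[K]_n.+1) (alpha : 'cV[K]_n.+1) (c : K),
     [/\ flag_pt x = <[v]>%VS,
         forall w, (w \in flag_hyp x) = (w *m alpha == 0)
       & adj_val a = c *: (alpha *m v)]].

(* The scalars of Ahat are normalized so that the projection phi is K-linear and
   not merely semilinear; only then is Ahat / ker phi ~ A one of K-modules. *)
Definition lifts_action (Ahat : lmodType K)
    (ehat : flag_geometry -> set Ahat) (phi : {linear Ahat -> adjoint n K})
    (act : raction (SL n K) Ahat) : Prop :=
  [/\ forall (x : flag) g, act^~ g @` ehat x = ehat (flag_act x g),
      forall u g, u \in kerp phi -> act u g \in kerp phi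
    & forall u g, phi (act u g) = adj_raction n K (phi u) g].

End FlagGeometry.

(* Main.v *)
Require Import Defs.
From HB Require Import structures.
From mathcomp Require Import all_boot all_algebra generic_quotient ring_quotient.
From mathcomp Require Import boolp classical_sets functions.
From mathcomp Require Import ring.

(** Flags are handled through representatives: a row vector [v] and a column
    vector [a] with [v a = 0], the natural embedding sending the flag to the
    rank one matrix [a v].

    Each point of a cover of the natural embedding contains exactly one vector
    above [a v], written [flag_vec v a]. Because lines go to lines, it is
    linear in [v] among the vectors killed by [a], and linear in [a] among the
    columns killed by [v]: it is a [flag_form]. Conversely a flag form [m] with
    values in any space [V] yields an embedding, with vectors [(a v, m v a)]
    ([form_is_embedding]), and this embedding covers the natural one. Applying
    the universality of the cover to it shows that [Ahat] is the universal
    target of flag forms ([universal_form]). The rest is deduced from this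
    property.

    Action. The flag form sending [v], [a] to [flag_vec (v g) (g^-1 a)] gives
    the linear map lifting [g] ([lift_exists]).

    Centrality. As transvections generate [SL], it is enough to treat one
    transvection [t] with centre [v] and axis [a]. For every flag not opposite
    to [(v, a)], [t - 1] sends its vectors into the span of the flags with
    point [v] or with hyperplane [a], and [phi] is injective on that span
    ([root_nbhd_inj]). The flags opposite to [(v, a)] add a single dimension,
    because they are connected to each other by lines ([near_opposite]), and
    this dimension is seen by [phi]. Hence [t - 1] kills the kernel of [phi].

    Non-splitting. A flag form invariant under [SL] vanishes: a transvection
    fixing [a] and moving [u] to [u + v] forces [m v a = 0]
    ([invariant_form_eq0]). For an equivariant section [s], the difference
    [s (a v) - flag_vec v a] is such a form, so that [s] is onto and the
    kernel is trivial.

    Cohomology. A linear form on the kernel, extended by [0] on a linear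
    complement, has a coboundary that factors through [A]; its class is the
    image of the form ([transgression]). Injectivity is again the vanishing of
    invariant forms. For surjectivity, write a cocycle as a function [c g x]
    of [g] in [SL] and [x] in [A]; one needs a flag form [m] such that
    [m (v g) (g^-1 a) = m v a + c g (a v)] ([cocycle_form]). When [u b = 1] and
    [v b = u a = 0], the transvection [1 + b v] moves [(u, a)] to
    [(u + v, a)], so necessarily [m v a = c (1 + b v) (a u)]. The heart of the
    matter is that this value does not depend on [b] and [u], which rests on
    [c (1 + a v) (b u) = 0] when the four pairings of [u], [v] with [a],
    [b] vanish ([cocycle_vanish]). For this to hold over every field, including
    those with too few scalars for a weight argument, it is derived from the
    commutation relations between the root elements attached to three or four
    vectors of a basis. *)

Set Implicit Arguments.
Unset Strict Implicit.
Unset Printing Implicit Defensive.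

Import GRing.Theory.
Local Open Scope classical_set_scope.
Local Open Scope ring_scope.

(** * Pairing rows with columns *)
Section Dot.
Variables (K : fieldType) (N : nat).
Implicit Types (u v w : 'rV[K]_N) (a b c : 'cV[K]_N).

Definition dot v a : K := (v *m a) 0 0.

Lemma dotE v a : v *m a = (dot v a)%:M.
Proof. by rewrite [LHS]mx11_scalar. Qed.

Lemma dot_eq0 v a : (v *m a == 0) = (dot v a == 0).
Proof.
apply/eqP/eqP => [|h]; first by rewrite /dot => ->; rewrite mxE.
by rewrite dotE h -scalemx1 scale0r.
Qed.

Lemma dotDl u v a : dot (u + v) a = dot u a + dot v a.
Proof. by rewrite /dot mulmxDl mxE. Qed.
Lemma dotDr v a b : dot v (a + b) = dot v a + dot v b.
Proof. by rewrite /dot mulmxDr mxE. Qed.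
Lemma dotZl k v a : dot (k *: v) a = k * dot v a.
Proof. by rewrite /dot -scalemxAl mxE. Qed.
Lemma dotZr k v a : dot v (k *: a) = k * dot v a.
Proof. by rewrite /dot -scalemxAr mxE. Qed.
Lemma dotNl v a : dot (- v) a = - dot v a.
Proof. by rewrite -scaleN1r dotZl mulN1r. Qed.
Lemma dotNr v a : dot v (- a) = - dot v a.
Proof. by rewrite -scaleN1r dotZr mulN1r. Qed.
Lemma dot0l a : dot 0 a = 0.
Proof. by rewrite /dot mul0mx mxE. Qed.
Lemma dot0r v : dot v 0 = 0.
Proof. by rewrite /dot mulmx0 mxE. Qed.

Definition dot_linE := (dotDl, dotDr, dotZl, dotZr, dotNl, dotNr, dot0l, dot0r).

Lemma dot_tr v a : dot a^T v^T = dot v a.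
Proof. by rewrite /dot -trmx_mul mxE. Qed.

Lemma dot_mulmx v (g : 'M_N) a : dot (v *m g) a = dot v (g *m a).
Proof. by rewrite /dot mulmxA. Qed.

Lemma mul_outer a v b w : a *m v *m (b *m w) = dot v b *: (a *m w).
Proof. by rewrite mulmxA -(mulmxA a v) dotE mul_mx_scalar -scalemxAl. Qed.

Lemma row_outer w a v : w *m (a *m v) = dot w a *: v.
Proof. by rewrite mulmxA dotE mul_scalar_mx. Qed.

Lemma outer_col a v b : a *m v *m b = dot v b *: a.
Proof. by rewrite -mulmxA dotE mul_mx_scalar. Qed.

Lemma tr_outer a v : \tr (a *m v) = dot v a.
Proof. by rewrite mxtrace_mulC dotE mxtrace_scalar. Qed.

(** The columns of the cokernel of [A] cut out its row space, so one of them
    does not kill [u]. *)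
Lemma separate p (A : 'M[K]_(p, N)) u : ~~ (u <= A)%MS ->
  exists2 b, A *m b = 0 & dot u b = 1.
Proof.
rewrite submxE => /eqP/matrixP h.
have [j hj] : exists j, (u *m cokermx A) 0 j != 0.
  apply/not_existsP => H; apply: h => i j; rewrite ord1 [RHS]mxE.
  by apply/eqP/negPn/negP/H.
set b := col j (cokermx A).
have db : dot u b = (u *m cokermx A) 0 j.
  by rewrite /dot /b colE mulmxA -colE mxE.
exists ((dot u b)^-1 *: b); last by rewrite dotZr mulVf // db.
by rewrite -scalemxAr /b colE mulmxA mulmx_coker mul0mx scaler0.
Qed.

Lemma separate1 u v : (forall k, u != k *: v) ->
  exists2 b, dot v b = 0 & dot u b = 1.
Proof.
move=> h; have [|b vb ub] := @separate _ v u.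
  by apply/negP => /sub_rVP[k hk]; move: (h k); rewrite hk eqxx.
by exists b => //; apply/eqP; rewrite -dot_eq0 vb.
Qed.

Lemma dual_vec v : v != 0 -> exists b, dot v b = 1.
Proof.
move=> v0; have [|b _ vb] := @separate1 v 0; last by exists b.
by move=> k; rewrite scaler0.
Qed.

(** The kernel of [A] has dimension at least [N - q > p]. *)
Lemma kernel_avoids p q (A : 'M[K]_(N, q)) (V : 'M[K]_(p, N)) : (q + p < N)%N ->
  exists2 u : 'rV_N, u *m A = 0 & ~~ (u <= V)%MS.
Proof.
move=> hN; have : ~~ (kermx A <= V)%MS.
  apply: contraL hN => /mxrankS; rewrite mxrank_ker -leqNgt leq_subLR => h.
  by apply: leq_trans h _; rewrite leq_add // ?rank_leq_col ?rank_leq_row.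
case/row_subPn => i hi; exists (row i (kermx A)) => //.
by rewrite -row_mul mulmx_ker row0.
Qed.

Lemma kernel_avoids1 a v : (2 < N)%N ->
  exists2 u, dot u a = 0 & forall k, u != k *: v.
Proof.
move=> hN; have [u ua uv] := @kernel_avoids 1 1 a v hN.
exists u; first by apply/eqP; rewrite -dot_eq0 ua.
by move=> k; apply: contra uv => /eqP ->; apply: scalemx_sub.
Qed.

Lemma kernel_meet a b : (2 < N)%N ->
  exists u, [/\ u != 0, dot u a = 0 & dot u b = 0].
Proof.
move=> hN; have [|u] := @kernel_avoids 0 (1 + 1) (row_mx a b) 0; first by rewrite addn0.
rewrite mul_mx_row -row_mx0 => /eq_row_mx[/eqP ua /eqP ub] u0.
exists u; split; last by apply/eqP; rewrite -dot_eq0.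
  by apply: contra u0 => /eqP ->; apply: sub0mx.
by apply/eqP; rewrite -dot_eq0.
Qed.


End Dot.

Section DotDual.
Variables (K : fieldType) (N : nat).
Implicit Types (u v w : 'rV[K]_N) (a b c : 'cV[K]_N).

Lemma separate1_col a b : (forall k, b != k *: a) ->
  exists2 u, dot u a = 0 & dot u b = 1.
Proof.
move=> h; have [|c ac bc] := @separate1 K N b^T a^T.
  by move=> k; apply: contra (h k) => /eqP H; rewrite -[b]trmxK H linearZ /= trmxK.
by exists c^T; rewrite -dot_tr trmxK.
Qed.

Lemma dual_col a : a != 0 -> exists u, dot u a = 1.
Proof.
move=> a0; have [|u _ ua] := @separate1_col 0 a; last by exists u.
by move=> k; rewrite scaler0.
Qed.

Lemma kernel_meet_col u v : (2 < N)%N ->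
  exists b, [/\ b != 0, dot u b = 0 & dot v b = 0].
Proof.
move=> hN; have [b [b0 ub vb]] := @kernel_meet K N u^T v^T hN.
by exists b^T; rewrite trmx_eq0 -!(dot_tr _ b^T) trmxK.
Qed.

(** Sylvester's identity: both sides are the determinant of the block matrix
    with rows [1, - a] and [v, 1]. *)
Lemma det_add1_outer a v : \det (1%:M + a *m v) = 1 + dot v a.
Proof.
have e1 : block_mx 1%:M (- a) v 1%:M *m block_mx 1%:M a 0 1%:M =
          block_mx 1%:M 0 v (1%:M + v *m a) :> 'M[K]_(N + 1).
  by rewrite mulmx_block !mulmx1 !mul1mx !mulmx0 !addr0 addrN addrC.
have e2 : block_mx 1%:M (- a) v 1%:M = block_mx 1%:M (- a) 0 1%:M *m
          block_mx (1%:M + a *m v) 0 v 1%:M :> 'M[K]_(N + 1).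
  by rewrite mulmx_block !mul1mx !mulmx0 !mulmx1 !mul0mx !add0r mulNmx addrK.
have := congr1 determinant e1; rewrite e2 !det_mulmx !det_ublock !det_lblock !det1.
rewrite !mul1r !mulr1 => ->; rewrite det_mx11 mxE mxE eqxx mulr1n.
by rewrite /dot.
Qed.

End DotDual.

(** * Generation by transvections *)
Section Transvections.
Variables (n : nat) (K : fieldType).
Implicit Types (g h : SL n K) (u v w : 'rV[K]_n.+1) (a b c : 'cV[K]_n.+1).

(** The default value of [insubd] is taken only when [v a] is nonzero. *)
Definition transvection a v : SL n K := insubd (1%g : SL n K) (1%:M + a *m v).

Lemma val_transvection a v :
  dot v a = 0 -> transvection a v = 1%:M + a *m v :> 'M_n.+1.
Proof. by move=> va; rewrite insubdK // -topredE /= det_add1_outer va addr0. Qed.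

Lemma SL_valM g h : (g * h)%g = g *m h :> 'M_n.+1.
Proof. by []. Qed.

Lemma SL_val1 : (1%g : SL n K) = 1%:M :> 'M_n.+1.
Proof. by []. Qed.

Lemma SL_mulV_val g : g *m (g^-1)%g = 1%:M :> 'M_n.+1.
Proof. by rewrite -SL_valM mulgV. Qed.

Lemma SL_mulVg_val g : (g^-1)%g *m g = 1%:M :> 'M_n.+1.
Proof. by rewrite -SL_valM mulVg. Qed.

Lemma transvectionM a b v : dot v a = 0 -> dot v b = 0 ->
  (transvection a v * transvection b v)%g = transvection (a + b) v.
Proof.
move=> va vb; apply: val_inj; rewrite /= !val_transvection ?dot_linE ?va ?vb ?addr0 //.
by rewrite mulmxDl mul1mx mulmxDr mulmx1 mul_outer vb scale0r addr0 mulmxDl addrAC addrA.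
Qed.

Lemma transvectionMr a v w : dot v a = 0 -> dot w a = 0 ->
  (transvection a v * transvection a w)%g = transvection a (v + w).
Proof.
move=> va wa; apply: val_inj; rewrite /= !val_transvection ?dot_linE ?va ?wa ?addr0 //.
by rewrite mulmxDl mul1mx mulmxDr mulmx1 mul_outer va scale0r addr0 mulmxDr addrAC addrA.
Qed.

Lemma transvection0 v : transvection 0 v = 1%g.
Proof. by apply: val_inj; rewrite /= val_transvection ?dot_linE // mul0mx addr0. Qed.

Lemma transvection0r a : transvection a 0 = 1%g.
Proof. by apply: val_inj; rewrite /= val_transvection ?dot_linE // mulmx0 addr0. Qed.

Lemma transvectionV a v : dot v a = 0 ->
  (transvection a v)^-1%g = transvection (- a) v.
Proof.
move=> va; apply: (mulgI (transvection a v)).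
by rewrite mulgV transvectionM ?dotNr ?va ?oppr0 // addrN transvection0.
Qed.

Lemma transvectionZ k a v : transvection (k *: a) v = transvection a (k *: v).
Proof. by rewrite /transvection -scalemxAl -scalemxAr. Qed.

Lemma row_transvection w a v : dot v a = 0 ->
  w *m transvection a v = w + dot w a *: v.
Proof. by move=> va; rewrite val_transvection // mulmxDr mulmx1 row_outer. Qed.

Lemma transvectionV_col a v b : dot v a = 0 ->
  (transvection a v)^-1%g *m b = b - dot v b *: a.
Proof.
move=> va; rewrite transvectionV // val_transvection ?dotNr ?va ?oppr0 //.
by rewrite mulmxDl mul1mx outer_col scalerN.
Qed.

(** Row reduction. If the first [k] rows of [g] are those of the identity,
    some entry of row [k] at a position [>= k] is nonzero. When one is found
    strictly after [k], a single transvection fixing the previous rows takes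
    row [k] to the unit vector; otherwise a first transvection creates it.
    In the last row the determinant leaves only a transvection. *)
Lemma SL_transvection_ind (P : SL n K -> Prop) :
    (forall g h, P g -> P h -> P (g * h)%g) ->
    (forall a v, dot v a = 0 -> P (transvection a v)) ->
  forall g, P g.
Proof.
move=> PM Pt.
pose e (i : 'I_n.+1) : 'rV[K]_n.+1 := delta_mx 0 i.
pose Q (k : nat) := forall g, (forall i : 'I_n.+1, (i < k)%N -> row i g = e i) -> P g.
have Pdiv g a v : dot v a = 0 -> P (g * transvection a v)%g -> P g.
  move=> va; rewrite -{2}[g](mulgK (transvection a v)) transvectionV // => h.
  by apply: PM => //; apply: Pt; rewrite dotNr va oppr0.
have dote i b : dot (e i) b = b i 0 by rewrite /dot -rowE mxE.
have dotd w i : dot w (delta_mx i 0) = w 0 i by rewrite /dot -colE mxE.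
suff H d k : (k + d = n)%N -> Q k by move=> g; apply: (H n 0%N (add0n n)) => i.
elim: d k => [|d IHd] k hk g hg.
  rewrite addn0 in hk; set r := row ord_max g.
  have off i j : i != ord_max -> (g : 'M_n.+1) i j = (i == j)%:R.
    move=> im; have ik : (i < k)%N.
      by rewrite hk ltn_neqAle -ltnS ltn_ord andbT.
    by have /rowP/(_ j) := hg i ik; rewrite !mxE eqxx eq_sym.
  have g1 : (g : 'M_n.+1) ord_max ord_max = 1.
    have <- := SL_det g; rewrite det_trig.
      rewrite (bigD1 ord_max) //= big1 ?mulr1 // => i im.
      by rewrite off // eqxx.
    apply/is_trig_mxP => i j ij; rewrite off ?(ltn_eqF ij) //; last first.
      by apply: contraTneq ij => ->; rewrite -leqNgt -ltnS.
    by rewrite -(inj_eq val_inj) (ltn_eqF ij).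
  suff -> : g = transvection (delta_mx ord_max 0) (r - e ord_max).
    by apply: Pt; rewrite /dot -colE !mxE g1 !eqxx subrr.
  apply: val_inj; rewrite /= val_transvection; last first.
    by rewrite dotd !mxE g1 !eqxx subrr.
  apply/matrixP => i j; rewrite !mxE big_ord1 !mxE eqxx /= andbT.
  have [->|im] := eqVneq i ord_max; first by rewrite mul1r (eq_sym j) addrC subrK.
  by rewrite mul0r addr0 off.
have kn : (k < n.+1)%N by rewrite ltnS -hk leq_addr.
have kn' : (k.+1 < n.+1)%N by rewrite ltnS -hk addnS ltnS leq_addr.
pose k0 := Ordinal kn; pose k1 := Ordinal kn'.
have rows g' a v : (forall i : 'I_n.+1, (i < k)%N -> row i g' = e i) ->
    dot v a = 0 -> (forall i : 'I_n.+1, (i < k)%N -> a i 0 = 0) ->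
    forall i : 'I_n.+1, (i < k)%N -> row i (g' * transvection a v)%g = e i.
  move=> hg' va ha i ik; rewrite SL_valM row_mul hg' // row_transvection //.
  by rewrite dote ha // scale0r addr0.
have tail g' (j : 'I_n.+1) : (forall i : 'I_n.+1, (i < k)%N -> row i g' = e i) ->
    (k < j)%N -> (g' : 'M_n.+1) k0 j != 0 -> P g'.
  move=> hg' kj gj; set v := row k0 g'.
  (* [a] takes the value 1 on row [k] and on the unit vector, so that the
     transvection along their difference moves one to the other. *)
  pose s : K := (1 - v 0 k0) / v 0 j.
  pose a : 'cV[K]_n.+1 := delta_mx k0 0 + s *: delta_mx j 0.
  have jk0 : (j == k0) = false by apply/eqP => /(congr1 val) /= E; rewrite E ltnn in kj.
  have va : dot v a = 1.
    have vj : v 0 j != 0 by rewrite mxE.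
    by rewrite dotDr dotZr !dotd /s (divfK vj) addrC subrK.
  have ea : dot (e k0) a = 1 by rewrite dote !mxE !eqxx /= eq_sym jk0 mulr0 addr0.
  have ua : dot (e k0 - v) a = 0 by rewrite dotDl dotNl va ea subrr.
  apply: (Pdiv g' a (e k0 - v)) => //.
  apply: (IHd k.+1); first by rewrite addSnnS.
  move=> i; rewrite ltnS leq_eqVlt => /orP[/eqP ik|ik]; last first.
    apply: rows => // i' i'k; rewrite !mxE !eqxx !andbT.
    have /negbTE -> : i' != k0 by apply: contraTneq i'k => ->; rewrite ltnn.
    have /negbTE -> : i' != j by apply: contraTneq i'k => ->; rewrite -leqNgt ltnW.
    by rewrite mulr0 addr0.
  have -> : i = k0 by apply: val_inj.
  by rewrite SL_valM row_mul row_transvection // va scale1r addrC subrK.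
have [[j kj gj]|no] := pselect (exists2 j : 'I_n.+1, (k < j)%N & (g : 'M_n.+1) k0 j != 0).
  exact: tail kj gj.
set v := row k0 g.
have vk : v 0 k0 != 0.
  apply/eqP => v0.
  have vsum : v = \sum_(i < n.+1 | (i < k)%N) v 0 i *: e i.
    rewrite {1}[v]row_sum_delta (bigID (fun i : 'I_n.+1 => (i < k)%N)) /=.
    rewrite [X in _ + X]big1 ?addr0 // => i; rewrite -leqNgt leq_eqVlt => /orP[/eqP ki|ki].
      by have <- : k0 = i by [apply: val_inj]; rewrite v0 scale0r.
    have -> : v 0 i = 0; last by rewrite scale0r.
    by rewrite mxE; apply/eqP/negPn/negP => h; apply: no; exists i.
  (* Otherwise [v] is a combination of the rows already reduced, so [g] fixes
     it although it maps the [k]-th unit vector to it. *)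
  have vg : v *m g = v.
    rewrite {1}vsum mulmx_suml [RHS]vsum; apply: eq_bigr => i ik.
    by rewrite -scalemxAl -rowE hg.
  have : (e k0 - v) *m g = 0 by rewrite mulmxBl -rowE -/v vg subrr.
  move/(congr1 (mulmx^~ (invmx g))); rewrite mulmxK ?SL_unit // mul0mx => /eqP.
  rewrite subr_eq0 => /eqP E; move: v0; rewrite -E mxE !eqxx => /eqP.
  by rewrite oner_eq0.
have k1k0 : (k1 == k0) = false by rewrite -(inj_eq val_inj) /= gtn_eqF.
have d0 : dot (e k1) (delta_mx k0 0) = 0 by rewrite dote mxE k1k0.
apply: (Pdiv g (delta_mx k0 0) (e k1)) => //.
apply: (tail _ k1) => //.
  apply: rows => // i ik; rewrite mxE.
  by have /negbTE -> : i != k0 by apply: contraTneq ik => ->; rewrite ltnn.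
have -> : (g * transvection (delta_mx k0 0) (e k1))%g k0 k1 =
    (row k0 (g * transvection (delta_mx k0 0) (e k1))%g) 0 k1 by rewrite [RHS]mxE.
rewrite SL_valM row_mul row_transvection // -/v.
rewrite dotd.
rewrite mxE [X in X + _]mxE.
have -> : (g : 'M_n.+1) k0 k1 = 0.
  by apply/eqP/negPn/negP => h; apply: no; exists k1 => //=.
by rewrite add0r mxE [X in _ * X]mxE !eqxx mulr1.
Qed.

End Transvections.

(** * Cocycles evaluated on matrices *)
Section ScalarCocycle.
Variables (n : nat) (K : fieldType).
Implicit Types (g h t : SL n K) (m : 'M[K]_n.+1).
Implicit Types (u v w : 'rV[K]_n.+1) (a b : 'cV[K]_n.+1).

Definition conj_mx m g : 'M[K]_n.+1 := (g^-1)%g *m m *m g.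

Lemma tr_conj_mx m g : \tr (conj_mx m g) = \tr m.
Proof. by rewrite /conj_mx -mulmxA mxtrace_mulC -mulmxA SL_mulV_val mulmx1. Qed.

Lemma conj_mx_id m g : m *m g = g *m m -> conj_mx m g = m.
Proof. by rewrite /conj_mx -mulmxA => ->; rewrite mulmxA SL_mulVg_val mul1mx. Qed.

Lemma conj_outer a v g : conj_mx (a *m v) g = ((g^-1)%g *m a) *m (v *m g).
Proof. by rewrite /conj_mx !mulmxA. Qed.

Lemma outer_mul_outer m a v :
  a *m v *m m *m (a *m v) = dot v (m *m a) *: (a *m v).
Proof.
by rewrite -(mulmxA a v m) mulmxA -(mulmxA a) -(mulmxA v) dotE mul_mx_scalar -scalemxAl.
Qed.

Lemma conj_transvection m a v : dot v a = 0 ->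
  conj_mx m (transvection a v) =
    m + (m *m a) *m v - a *m (v *m m) - dot v (m *m a) *: (a *m v).
Proof.
move=> va; rewrite /conj_mx transvectionV // !val_transvection ?dot_linE ?va ?oppr0 //.
rewrite mulmxDr mulmx1 !mulmxDl !mul1mx !mulNmx.
rewrite outer_mul_outer.
by rewrite !mulmxA -!addrA; congr (_ + _); rewrite addrCA.
Qed.

(** A cocycle of [SL] in the dual of the traceless matrices, read as a
    function of two arguments. Asking for linearity on all matrices allows the
    diagonal matrix units to be used separately; the cocycle identity makes
    sense on traceless matrices only. *)
Record scalar_cocycle (c : SL n K -> 'M[K]_n.+1 -> K) : Prop := ScalarCocycle {
  sc_linear : forall g k m m', c g (k *: m + m') = k * c g m + c g m';
  sc_mul : forall g h m, \tr m = 0 -> c (g * h)%g m = c h (conj_mx m g) + c g m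
}.

Variables (c : SL n K -> 'M[K]_n.+1 -> K).
Hypothesis cP : scalar_cocycle c.

Lemma sc0 g : c g 0 = 0.
Proof.
have := sc_linear cP g 1 0 0; rewrite scaler0 addr0 mul1r => /eqP.
by rewrite -subr_eq0 opprD addrA subrr sub0r oppr_eq0 => /eqP.
Qed.
Lemma scD g m m' : c g (m + m') = c g m + c g m'.
Proof. by have := sc_linear cP g 1 m m'; rewrite scale1r mul1r. Qed.
Lemma scZ g k m : c g (k *: m) = k * c g m.
Proof. by have := sc_linear cP g k m 0; rewrite addr0 sc0 addr0. Qed.
Lemma scN g m : c g (- m) = - c g m.
Proof. by rewrite -scaleN1r scZ mulN1r. Qed.
Lemma scB g m m' : c g (m - m') = c g m - c g m'.
Proof. by rewrite scD scN. Qed.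

Lemma sc1 m : \tr m = 0 -> c 1%g m = 0.
Proof.
move=> m0; have := sc_mul cP 1%g 1%g m0.
rewrite mulg1 conj_mx_id ?mulmx1 ?mul1mx // => /eqP.
by rewrite -subr_eq0 opprD addrA subrr sub0r oppr_eq0 => /eqP.
Qed.

(** Compare the two expansions of [c (g * h) m = c (h * g) m]. *)
Lemma sc_commute g h m : \tr m = 0 -> (g * h = h * g)%g ->
  c g (conj_mx m h - m) = c h (conj_mx m g - m).
Proof.
move=> m0 gh; have := sc_mul cP g h m0; rewrite gh (sc_mul cP) // !scB => H.
by apply/eqP; rewrite subr_eq addrAC -H addrK.
Qed.

(** Compare the two expansions of [c (t * h) m = c (h * g) m]. *)
Lemma sc_conj g h t m : \tr m = 0 -> (t * h = h * g)%g ->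
  c g (conj_mx m h) = c t m + c h (conj_mx m t - m).
Proof.
move=> m0 th; have := sc_mul cP t h m0; rewrite th (sc_mul cP) // scB => H.
by apply: (addIr (c h m)); rewrite H -addrA subrK addrC.
Qed.

End ScalarCocycle.

(** * Cocycles on the root elements of a frame *)
Section Frame.
Variables (n : nat) (K : fieldType) (c : SL n K -> 'M[K]_n.+1 -> K).
Hypothesis cP : scalar_cocycle c.
Variables (r : nat) (e : 'I_r -> 'rV[K]_n.+1) (f : 'I_r -> 'cV[K]_n.+1).
Hypothesis ef : forall i j, dot (e i) (f j) = (i == j)%:R.
Implicit Types (i j k l p q : 'I_r) (s : K).

(** In a frame [e], [f] the matrices [f i *m e j] multiply like the usual
    matrix units, whatever the size of the frame. *)
Definition frame_unit i j : 'M[K]_n.+1 := f i *m e j.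
Definition root_elt i j s : SL n K := transvection (f i) (s *: e j).
Local Notation E := frame_unit.
Local Notation X := root_elt.
Local Notation C i j s k l := (c (X i j s) (E k l)).

Lemma tr_unit i j : \tr (E i j) = (i == j)%:R.
Proof. by rewrite tr_outer ef eq_sym. Qed.

Lemma mul_unit i j k l : E i j *m E k l = (j == k)%:R *: E i l.
Proof. by rewrite mul_outer ef. Qed.

Lemma dot_root i j s : i != j -> dot (s *: e j) (f i) = 0.
Proof. by move=> ij; rewrite dotZl ef eq_sym (negbTE ij) mulr0. Qed.

Lemma val_root i j s : i != j -> X i j s = 1%:M + s *: E i j :> 'M_n.+1.
Proof. by move=> ij; rewrite val_transvection ?dot_root // -scalemxAr. Qed.

Lemma root_add i j s s' : i != j -> (X i j s * X i j s')%g = X i j (s + s').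
Proof. by move=> ij; rewrite transvectionMr ?dot_root // -scalerDl. Qed.

Lemma root_0 i j : X i j 0 = 1%g.
Proof. by rewrite /root_elt scale0r transvection0r. Qed.

Lemma root_comm i j k l s s' : i != j -> k != l -> j != k -> l != i ->
  (X i j s * X k l s' = X k l s' * X i j s)%g.
Proof.
move=> ij kl jk li; apply: val_inj; rewrite /= !val_root //.
rewrite !mulmxDl !mulmxDr !mul1mx !mulmx1 -!scalemxAl -!scalemxAr !mul_unit.
by rewrite (negbTE jk) (negbTE li) !scale0r !scaler0 !addr0 -!addrA; congr (_ + _); rewrite addrC.
Qed.

Lemma conj_root m i j s : i != j -> conj_mx m (X i j s) - m =
  s *: (m *m E i j) - s *: (E i j *m m) - s ^+ 2 *: (E i j *m m *m E i j).
Proof.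
move=> ij; rewrite conj_transvection ?dot_root // [LHS]addrC !addrA addNr add0r -[RHS]addrA -[LHS]addrA.
rewrite -!scalemxAr -!scalemxAl !scalerA dotZl; congr (_ + (_ - _)).
- by rewrite mulmxA.
- by rewrite -scalemxAr mulmxA.
by rewrite outer_mul_outer scalerA expr2 mulrAC.
Qed.

Lemma conj_root_unit i j s p q : i != j -> conj_mx (E p q) (X i j s) - E p q =
  (s * (q == i)%:R) *: E p j - (s * (j == p)%:R) *: E i q
  - (s ^+ 2 * (j == p)%:R * (q == i)%:R) *: E i j.
Proof.
by move=> ij; rewrite conj_root // !mul_unit -!scalemxAl mul_unit !scalerA.
Qed.

Lemma conj_root_diag i j s p q : i != j ->
  conj_mx (E p p - E q q) (X i j s) - (E p p - E q q) =
  (s * ((p == i)%:R - (p == j)%:R - (q == i)%:R + (q == j)%:R)) *: E i j.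
Proof.
move=> ij; rewrite conj_root // mulmxBl mulmxBr mulmxBl !mul_unit -!scalemxAl !mul_unit.
have h x : (j == x)%:R * (x == i)%:R = 0 :> K.
  by case: eqP => [<-|]; rewrite ?mul0r // eq_sym (negbTE ij) mulr0.
rewrite !scalerA !h !scale0r subr0 scaler0 subr0 !(eq_sym j).
have e1 (F : 'I_r -> 'M[K]_n.+1) x y : (x == y)%:R *: F x = (x == y)%:R *: F y.
  by case: eqP => [->|] //; rewrite !scale0r.
rewrite (e1 (E^~ j) p i) (e1 (E^~ j) q i) (e1 (E i) p j) (e1 (E i) q j).
by rewrite -!scalerBr -!scalerBl scalerA; congr (_ *: _); ring.
Qed.

(** The relation [sc_commute] for two commuting root elements is the source of
    all the linear equations between the values of [c] used below; it is made
    explicit for a matrix unit off the diagonal and for a diagonal matrix. *)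
Lemma commute_unit i j k l p q s s' :
  i != j -> k != l -> j != k -> l != i -> p != q ->
  s' * (q == k)%:R * C i j s p l - s' * (l == p)%:R * C i j s k q
    - s' ^+ 2 * (l == p)%:R * (q == k)%:R * C i j s k l =
  s * (q == i)%:R * C k l s' p j - s * (j == p)%:R * C k l s' i q
    - s ^+ 2 * (j == p)%:R * (q == i)%:R * C k l s' i j.
Proof.
move=> ij kl jk li pq.
have := sc_commute cP (m := E p q) _ (root_comm s s' ij kl jk li).
rewrite tr_unit (negbTE pq) => /(_ erefl).
by rewrite !conj_root_unit // !(scB cP) !(scZ cP).
Qed.

Lemma commute_diag i j k l p q s s' :
  i != j -> k != l -> j != k -> l != i ->
  s' * ((p == k)%:R - (p == l)%:R - (q == k)%:R + (q == l)%:R) * C i j s k l =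
  s * ((p == i)%:R - (p == j)%:R - (q == i)%:R + (q == j)%:R) * C k l s' i j.
Proof.
move=> ij kl jk li.
have := sc_commute cP (m := E p p - E q q) _ (root_comm s s' ij kl jk li).
rewrite linearB /= !tr_unit !eqxx subrr => /(_ erefl).
by rewrite !conj_root_diag // !(scZ cP).
Qed.

Lemma root_inverse i j s m : i != j -> \tr m = 0 -> conj_mx m (X i j s) = m ->
  c (X i j (- s)) m = - c (X i j s) m.
Proof.
move=> ij m0 hm; have := sc_mul cP (X i j s) (X i j (- s)) m0.
rewrite root_add // subrr root_0 (sc1 cP) // hm => /esym/eqP.
by rewrite addr_eq0 => /eqP.
Qed.

Lemma conj_unit_id i j s p q : i != j -> q != i -> p != j -> conj_mx (E p q) (X i j s) = E p q.
Proof.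
move=> ij qi pj; apply/eqP; rewrite -subr_eq0 conj_root_unit //.
by rewrite (negbTE qi) (eq_sym j) (negbTE pj) !mulr0 !scale0r !subr0.
Qed.

(** The diagonal element with [-1] at [p] and [q], written as a product of two
    rank one perturbations of determinant [-1]. *)
Definition sign_elt p q : SL n K := insubd (1%g : SL n K)
  ((1%:M + f p *m (-2%:R *: e p)) *m (1%:M + f q *m (-2%:R *: e q))).

Lemma val_sign p q : p != q ->
  sign_elt p q = 1%:M - 2%:R *: E p p - 2%:R *: E q q :> 'M_n.+1.
Proof.
move=> pq; rewrite insubdK.
  rewrite mulmxDl mul1mx mulmxDr mulmx1 -!scalemxAr -!scalemxAl mul_unit.
  by rewrite (negbTE pq) scale0r !scaler0 addr0 !scaleNr -addrA [X in _ + X]addrC addrA addrAC.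
rewrite -topredE /= det_mulmx !det_add1_outer !dotZl !ef !eqxx mulr1.
by apply/eqP; ring.
Qed.

Lemma sign_conj i j k l p q s : p != q -> i != j ->
    ((j == p) || (j == q)) = ~~ ((i == p) || (i == q)) ->
    ((l == p) || (l == q)) = ((k == p) || (k == q)) -> k != l -> l != i -> k != j ->
  C i j (- s) k l = C i j s k l.
Proof.
move=> pq ij hij hkl kl li kj.
have sr a b : E a b *m sign_elt p q = (if (b == p) || (b == q) then -1 else 1) *: E a b.
  rewrite val_sign // !mulmxBr mulmx1 -!scalemxAr !mul_unit.
  have e1 x y : (x == y)%:R *: E a y = (x == y)%:R *: E a x.
    by case: eqP => [->|] //; rewrite !scale0r.
  rewrite !e1 !scalerA -{1}[E a b]scale1r -!scalerBl; congr (_ *: _).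
  case: (eqVneq b p) => [->|bp] /=; first by rewrite (negbTE pq) /=; ring.
  by case: (b == q) => /=; ring.
have sl a b : sign_elt p q *m E a b = (if (a == p) || (a == q) then -1 else 1) *: E a b.
  rewrite val_sign // !mulmxBl mul1mx -!scalemxAl !mul_unit.
  have e1 x y : (x == y)%:R *: E x b = (x == y)%:R *: E y b.
    by case: eqP => [->|] //; rewrite !scale0r.
  rewrite !e1 !scalerA -{1}[E a b]scale1r -!scalerBl; congr (_ *: _).
  rewrite !(eq_sym _ a).
  case: (eqVneq a p) => [->|bp] /=; first by rewrite (negbTE pq) /=; ring.
  by case: (a == q) => /=; ring.
have := sc_conj cP (g := X i j (- s)) (h := sign_elt p q) (t := X i j s) (m := E k l).
rewrite tr_unit (negbTE kl) conj_unit_id // subrr (sc0 cP) addr0 => <- //.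
  by rewrite conj_mx_id // sr sl hkl.
apply: val_inj; rewrite /= !val_root // mulmxDl mulmxDr mul1mx mulmx1.
rewrite -scalemxAl -scalemxAr sr sl hij; congr (_ + _).
by rewrite !scalerA; case: (_ || _) => /=; congr (_ *: _); ring.
Qed.


(** Evaluates the Kronecker symbols from the distinctness hypotheses. *)
Ltac off_diag := repeat match goal with
  | H : is_true (?x != ?y) |- context [?x == ?y] => rewrite (negbTE H)
  | H : is_true (?x != ?y) |- context [?y == ?x] => rewrite (eq_sym y x) (negbTE H)
  end; rewrite ?eqxx /= ?(expr1n, mulr0, mul0r, mulr1, mul1r, subr0, sub0r, addr0, add0r,
    oppr0, opprK).

Section Three.
Variables (i j k : 'I_r).
Hypotheses (ij : i != j) (ik : i != k) (jk : j != k).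

Let ji : j != i. Proof. by rewrite eq_sym. Qed.
Let ki : k != i. Proof. by rewrite eq_sym. Qed.
Let kj : k != j. Proof. by rewrite eq_sym. Qed.

(** [X i j 1] moves [E k i] by [E k j] and commutes with [X k j s], which fixes
    [E k i]. *)
Lemma vanish_same s : C k j s k j = 0.
Proof.
have := commute_unit 1 s ij kj jk ji ki.
by off_diag; move=> <-.
Qed.

(** Two diagonal matrices in the commutation of [X k j] with [X k i] give
    [2 x = y] and [- x = y], hence [3 x = 0], and conjugation by an element of
    the torus gives [2 x = 0]. *)
Lemma vanish_row : C k j 1 k i = 0.
Proof.
set x := C k j 1 k i; pose y := C k i 1 k j.
have e1 : 2 * x = y.
  by have := @commute_diag k j k i k i 1 1 kj ki jk ik; off_diag; rewrite /x /y; move=> <-; ring.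
have e2 : - x = y.
  by have := @commute_diag k j k i i j 1 1 kj ki jk ik; off_diag; rewrite mulN1r.
have e3 : C k j (-1) k i = - x.
  by apply: root_inverse; rewrite ?tr_unit ?conj_unit_id //; off_diag.
have e4 : - x = x by rewrite -e3; apply: (@sign_conj k j k i k i) => //; off_diag.
have -> : x = 2 * x + x + (- x - x) by ring.
by rewrite {1}e4 subrr addr0 e1 -e2 addNr.
Qed.

Lemma vanish_col : C k j 1 i j = 0.
Proof.
set x := C k j 1 i j; pose y := C i j 1 k j.
have e1 : 2 * x = y.
  by have := @commute_diag k j i j i j 1 1 kj ij ji jk; off_diag; rewrite /x /y; move=> <-; ring.
have e2 : - x = y.
  by have := @commute_diag k j i j k i 1 1 kj ij ji jk; off_diag; rewrite mulN1r.
have e3 : C k j (-1) i j = - x.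
  by apply: root_inverse; rewrite ?tr_unit ?conj_unit_id //; off_diag.
have e4 : - x = x by rewrite -e3; apply: (@sign_conj k j i j i j) => //; off_diag.
have -> : x = 2 * x + x + (- x - x) by ring.
by rewrite {1}e4 subrr addr0 e1 -e2 addNr.
Qed.

(** In characteristic 2 the root element [X k j 1] is an involution. *)
Lemma vanish_diag_char2 : 2%:R = 0 :> K -> C k j 1 j j = C k j 1 k k.
Proof.
move=> K2; have := sc_mul cP (X k j 1) (X k j 1) (m := E j k).
rewrite tr_unit (negbTE jk) root_add // -[1 + 1]/(2%:R) K2 root_0 (sc1 cP) ?tr_unit ?(negbTE jk) //.
move=> /(_ erefl); rewrite -[conj_mx _ _](subrK (E j k)) conj_root_unit // (scD cP) -addrA.
have two x : x + x = 0 :> K by rewrite -mulr2n -mulr_natl K2 mul0r.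
rewrite two !(scB cP) !(scZ cP) vanish_same; off_diag.
by move/esym/eqP; rewrite subr_eq0 => /eqP.
Qed.

(** The commutations of [X k j] with [X i j] and with [X k i] express the two
    remaining kinds of values by the same diagonal coefficients of
    [c (X k j 1)]. *)
Lemma short_root_diag s : C i j s k i = s * (C k j 1 i i - C k j 1 j j).
Proof.
have := @commute_unit i j k j j i s 1 ij kj jk ji ji.
off_diag; rewrite vanish_col mulr0 subr0 => /(congr1 -%R); rewrite opprK => ->.
by ring.
Qed.

Lemma short_root_diag' : C k i 1 i j = C k j 1 i i - C k j 1 k k.
Proof.
have := @commute_unit k i k j i k 1 1 ki kj ik jk ik.
by off_diag; rewrite vanish_row subr0.
Qed.

Lemma short_root_scale s : C i j s k i = s * C i j 1 k i.
Proof. by rewrite short_root_diag [in RHS]short_root_diag mul1r. Qed.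

(** Evaluating [c] on a diagonal matrix along the commutator relation
    [X k i * X i j = X i j * X k i * X k j] shows that twice the sum of the two
    sides vanishes. In characteristic 2 the sum is zero by
    [vanish_diag_char2]. *)
Lemma short_root_swap : C i j 1 k i = - C k i 1 i j.
Proof.
have hz : (X k i 1 * X i j 1 = (X i j 1 * X k i 1) * X k j 1)%g.
  apply: val_inj; rewrite /= !val_root // !scale1r.
  rewrite !(mulmxDl, mulmxDr) !mul1mx !mulmx1 !mul_unit; off_diag.
  rewrite !scale0r !scale1r !mul0mx !addr0 !addrA; congr (_ + _).
  by rewrite addrAC.
pose d := E i i - E j j.
have d0 : \tr d = 0 by rewrite linearB /= !tr_unit !eqxx subrr.
have hx : conj_mx d (X k i 1) = d - E k i.
  rewrite -[LHS](subrK d) conj_root_diag //; off_diag.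
  by rewrite scaleN1r addrC.
have hy : conj_mx d (X i j 1) = d + 2%:R *: E i j.
  rewrite -[LHS](subrK d) conj_root_diag //; off_diag.
  by rewrite addrC.
have hyx : conj_mx (conj_mx d (X i j 1)) (X k i 1) =
    d - E k i + 2%:R *: (E i j - E k j).
  rewrite hy.
  have -> : conj_mx (d + 2%:R *: E i j) (X k i 1) =
     conj_mx d (X k i 1) + 2%:R *: conj_mx (E i j) (X k i 1).
    by rewrite /conj_mx mulmxDr mulmxDl -scalemxAr -scalemxAl.
  rewrite hx -[conj_mx (E i j) _](subrK (E i j)) conj_root_unit //; off_diag.
  by rewrite !scale0r scale1r subr0 sub0r addrC [in RHS]addrC (addrC (- _)).
have hM g h : conj_mx (conj_mx d g) h = conj_mx d (g * h)%g.
  by rewrite /conj_mx invgM !SL_valM !mulmxA.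
have := sc_mul cP (X k i 1) (X i j 1) d0.
rewrite hz (sc_mul cP) // (sc_mul cP (X i j 1)) // -hM hyx hx hy.
rewrite !((scD cP), (scN cP), (scZ cP)) vanish_same vanish_row vanish_col.
rewrite short_root_diag' short_root_diag mul1r => H.
have {}H : 2%:R * (C k j 1 j j - C k j 1 i i + (C k j 1 k k - C k j 1 i i)) = 0.
  move/eqP: H; rewrite -subr_eq0 => /eqP H.
  apply: oppr_inj; rewrite oppr0 -H; ring.
apply/eqP; rewrite -addr_eq0; move/eqP: H.
rewrite mulf_eq0 => /orP[/eqP K2|/eqP H].
  rewrite (vanish_diag_char2 K2).
  have -> x y : x - y + (x - y) = 2%:R * (x - y) :> K by move=> *; ring.
  by rewrite K2 mul0r.
by rewrite -oppr_eq0 -H; apply/eqP; ring.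
Qed.

End Three.

(** A diagonal matrix gives [2 x = 0]. In characteristic 2, the commutations
    among [X i k], [X i l], [X j k] and [X j l] express [x] as a difference of
    two diagonal coefficients of [c (X i l 1)] that is twice another one. *)
Lemma vanish_disjoint i j k l : i != j -> i != k -> i != l -> j != k ->
  j != l -> k != l -> C i l 1 j k = 0.
Proof.
move=> ij ik il jk jl kl.
have ji : j != i by rewrite eq_sym.
have ki : k != i by rewrite eq_sym.
have li : l != i by rewrite eq_sym.
have kj : k != j by rewrite eq_sym.
have lj : l != j by rewrite eq_sym.
have lk : l != k by rewrite eq_sym.
have: 2%:R * C i l 1 j k = 0.
  by have := @commute_diag i l j k j k 1 1 il jk lj ki; off_diag => <-; congr (_ * _); ring.
move/eqP; rewrite mulf_eq0 => /orP[/eqP K2|/eqP //].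
have e1 : C i k 1 k l = C i l 1 k k - C i l 1 i i.
  have := @commute_unit i k i l k i 1 1 ik il ki li ki.
  by off_diag; rewrite (@vanish_row k l i) // subr0.
have e2 : C i k 1 k l = - C j l 1 i j.
  by have := @commute_unit i k j l k j 1 1 ik jl kj li kj; off_diag.
have e3 : - C j l 1 i j = C i l 1 l l - C i l 1 j j.
  have := @commute_unit j l i l l j 1 1 jl il li lj lj.
  by off_diag; rewrite (@vanish_col j l i) // subr0.
have e4 : C i l 1 j k = C i l 1 k k - C i l 1 j j.
  have := @commute_unit j k i l k j 1 1 jk il ki lj kj.
  by off_diag => /esym/eqP; rewrite subr_eq0 => /eqP <-.
have e5 := @vanish_diag_char2 j l i jl ji li K2.
have {e1 e2}e6 : C i l 1 k k - C i l 1 i i = C i l 1 i i - C i l 1 j j.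
  by rewrite -e1 e2 e3 e5.
rewrite e4 -(subrK (C i l 1 i i) (C i l 1 k k)) e6.
transitivity (2%:R * (C i l 1 i i - C i l 1 j j)); first by ring.
by rewrite K2 mul0r.
Qed.

End Frame.

(** * Completing vectors to a frame *)
Section FrameCompletion.
Variables (K : fieldType) (N : nat).

(** [C'] and [D^T] are one-sided inverses of [R] and [C]; the correction by
    [D^T *m C' *m R] makes the new rows and columns orthogonal. *)
Lemma complete_mx p q (R : 'M[K]_(p, N)) (C : 'M[K]_(N, q)) :
    row_free R -> row_free C^T -> R *m C = 0 ->
  exists (R' : 'M[K]_(q, N)) (C' : 'M[K]_(N, p)),
    [/\ R *m C' = 1%:M, R' *m C = 1%:M & R' *m C' = 0].
Proof.
move=> /row_freeP[C' RC'] /row_freeP[D CD] RC.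
have DC : D^T *m C = 1%:M by rewrite -[C]trmxK -trmx_mul CD trmx1.
exists (D^T - D^T *m C' *m R), C'; split => //.
  by rewrite mulmxBl -!mulmxA RC !mulmx0 subr0.
by rewrite mulmxBl -!mulmxA RC' mulmx1 subrr.
Qed.

Lemma complete_frame p q (us : 'I_p -> 'rV[K]_N) (bs : 'I_q -> 'cV[K]_N) :
    row_free (\matrix_i us i) -> row_free (\matrix_i (bs i)^T) ->
    (forall i j, dot (us i) (bs j) = 0) ->
  exists (e : 'I_(p + q) -> 'rV[K]_N) (f : 'I_(p + q) -> 'cV[K]_N),
    [/\ forall i j, dot (e i) (f j) = (i == j)%:R,
        forall i, e (lshift q i) = us i & forall j, f (rshift p j) = bs j].
Proof.
move=> ufree bfree ub.
pose R := \matrix_i us i; pose C := (\matrix_i (bs i)^T)^T.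
have RC : R *m C = 0.
  apply/matrixP => i j; rewrite [RHS]mxE -(ub i j) /dot !mxE.
  by apply: eq_bigr => k _; rewrite !mxE.
have [|R' [C' [RC' R'C R'C']]] := complete_mx ufree _ RC; first by rewrite trmxK.
pose e i := row i (col_mx R R'); pose f j := col j (row_mx C' C).
have ef i j : dot (e i) (f j) = (col_mx R R' *m row_mx C' C) i j.
  rewrite /dot /e /f !mxE; apply: eq_bigr => k _.
  by rewrite [row _ _ _ _]mxE [col _ _ _ _]mxE.
exists e, f; split=> [i j|i|j].
- rewrite ef mul_col_row RC' RC R'C R'C'.
  by rewrite -scalar_mx_block mxE.
- by rewrite /e rowKu rowK.
- by apply/colP => k; rewrite /f colKr !mxE.
Qed.

Lemma row_free1 (v : 'rV[K]_N) : v != 0 -> row_free (\matrix_(i < 1) v).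
Proof.
move=> v0; have -> : \matrix_(i < 1) v = v by apply/matrixP => i j; rewrite !mxE ord1.
by rewrite /row_free rank_rV v0.
Qed.

Definition pair_fun T (x y : T) (i : 'I_2) := if i == 0 then x else y.

Lemma row_free2 (u v : 'rV[K]_N) : v != 0 -> (forall k, u != k *: v) ->
  row_free (\matrix_i pair_fun v u i).
Proof.
move=> v0 uv; apply: inj_row_free => x.
rewrite mulmx_sum_row !big_ord_recl big_ord0 addr0 !rowK /pair_fun /= => H.
have x1 : x 0 (lift ord0 ord0) = 0.
  apply/eqP/negPn/negP => x1; move: (uv (- (x 0 ord0 / x 0 (lift ord0 ord0)))).
  case/eqP; apply: (scalerI x1); rewrite scalerA mulrN mulrCA divff // mulr1 scaleNr.
  by apply/eqP; rewrite -addr_eq0 addrC H.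
move: H; rewrite x1 scale0r addr0 => /eqP; rewrite scaler_eq0 (negbTE v0) orbF => /eqP x0.
by apply/rowP => -[[|[|//]] h]; rewrite mxE -[RHS]/0; [rewrite -[RHS]x0|rewrite -[RHS]x1];
  congr (x _ _); apply: val_inj.
Qed.

End FrameCompletion.

(** * The flag form of a cocycle *)

(** The abstract counterpart of the vectors lying above the matrices [a v] in a
    cover: a pair represents a flag only if [v a = 0], so bilinearity is partial. *)
Definition flag_form (n : nat) (K : fieldType) (V : lmodType K)
    (m : 'rV[K]_n.+1 -> 'cV[K]_n.+1 -> V) : Prop :=
  (forall k u v a, dot u a = 0 -> dot v a = 0 ->
     m (k *: u + v) a = k *: m u a + m v a) /\
  (forall k v a b, dot v a = 0 -> dot v b = 0 ->
     m v (k *: a + b) = k *: m v a + m v b).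

Section CocycleForm.
Variables (n : nat) (K : fieldType) (c : SL n K -> 'M[K]_n.+1 -> K).
Hypotheses (n2 : (2 <= n)%N) (cP : scalar_cocycle c).
Implicit Types (u v w : 'rV[K]_n.+1) (a b : 'cV[K]_n.+1).
Local Notation T := (@transvection n K).

Let N3 : (2 < n.+1)%N. Proof. by []. Qed.

Lemma proportional_row u v : (exists k, u = k *: v) \/ (forall k, u != k *: v).
Proof.
have [h|h] := pselect (exists k, u = k *: v); [by left|right=> k].
by apply/eqP => E; apply: h; exists k.
Qed.

Lemma proportional_col a b : (exists k, a = k *: b) \/ (forall k, a != k *: b).
Proof.
have [h|h] := pselect (exists k, a = k *: b); [by left|right=> k].
by apply/eqP => E; apply: h; exists k.
Qed.

Lemma tr_col_neq a b : (forall k, a != k *: b) -> forall k, a^T != k *: b^T.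
Proof.
move=> h k; apply: contra (h k) => /eqP E.
by rewrite -[a]trmxK E linearZ /= trmxK.
Qed.

(** Depending on whether [u], [v] and [a], [b] are proportional, the four
    vectors extend to a frame of three or four vectors in which the value is
    one of those computed above. If both pairs are proportional, the third
    vector of the frame is an auxiliary one, available since [n >= 2]. *)
Lemma cocycle_vanish a b u v : dot v a = 0 -> dot u b = 0 -> dot v b = 0 ->
  dot u a = 0 -> c (T a v) (b *m u) = 0.
Proof.
move=> va ub vb ua.
have tbu : \tr (b *m u) = 0 by rewrite tr_outer.
have [->|a0] := eqVneq a 0; first by rewrite transvection0 (sc1 cP).
have [v0|v0] := eqVneq v 0; first by rewrite v0 transvection0r (sc1 cP).
pose i0 : 'I_2 := ord0; pose i1 : 'I_2 := lift ord0 ord0.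
have [[k ->]|ba] := proportional_col b a.
  rewrite -scalemxAl (scZ cP).
  have [[k' ->]|uv] := proportional_row u v.
    have [w wa wv] := kernel_avoids1 a v N3.
    have [||i j|e [f [ef he hf]]] := @complete_frame K n.+1 2 1 (pair_fun v w) (fun=> a).
    - exact: row_free2.
    - by apply: row_free1; rewrite trmx_eq0.
    - by rewrite /pair_fun; case: ifP.
    have := @vanish_same _ _ _ cP _ e f ef
      (lshift 1 i1) (lshift 1 i0) (rshift 2 ord0) isT isT isT 1.
    rewrite /root_elt /frame_unit !he !hf scale1r /pair_fun /= => H.
    by rewrite -scalemxAr (scZ cP) H !mulr0.
  have [||i j|e [f [ef he hf]]] := @complete_frame K n.+1 2 1 (pair_fun v u) (fun=> a).
  - exact: row_free2.
  - by apply: row_free1; rewrite trmx_eq0.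
  - by rewrite /pair_fun; case: ifP.
  have := @vanish_row _ _ _ cP _ e f ef (lshift 1 i1) (lshift 1 i0) (rshift 2 ord0) isT isT isT.
  rewrite /root_elt /frame_unit !he !hf scale1r /pair_fun /= => ->.
  by rewrite mulr0.
have bfree : row_free (\matrix_i (pair_fun a b i)^T).
  have -> : (\matrix_i (pair_fun a b i)^T) = \matrix_i pair_fun a^T b^T i.
    by apply/matrixP => i j; rewrite !mxE /pair_fun; case: ifP; rewrite mxE.
  by apply: row_free2; [rewrite trmx_eq0|exact: tr_col_neq].
have [[k ->]|uv] := proportional_row u v.
  rewrite -scalemxAr (scZ cP).
  have [||i j|e [f [ef he hf]]] := @complete_frame K n.+1 1 2 (fun=> v) (pair_fun a b).
  - exact: row_free1.
  - exact: bfree.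
  - by rewrite /pair_fun; case: ifP.
  have := @vanish_col _ _ _ cP _ e f ef (rshift 1 i1) (lshift 2 ord0) (rshift 1 i0) isT isT isT.
  rewrite /root_elt /frame_unit !he !hf scale1r /pair_fun /= => ->.
  by rewrite mulr0.
have [||i j|e [f [ef he hf]]] := @complete_frame K n.+1 2 2 (pair_fun v u) (pair_fun a b).
- exact: row_free2.
- exact: bfree.
- by rewrite /pair_fun; do 2 case: ifP.
have := @vanish_disjoint _ _ _ cP _ e f ef
  (rshift 2 i0) (rshift 2 i1) (lshift 2 i1) (lshift 2 i0) isT isT isT isT isT isT.
by rewrite /root_elt /frame_unit !he !hf scale1r /pair_fun /= => ->.
Qed.

(** The two transvections differ by one with axis [b' - b], which kills both
    [u] and [v]. *)
Lemma value_change_col a b b' u v : dot v a = 0 -> dot u a = 0 ->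
  dot v b = 0 -> dot v b' = 0 -> dot u b = dot u b' ->
  c (T b v) (a *m u) = c (T b' v) (a *m u).
Proof.
move=> va ua vb vb' ubb'.
have au : \tr (a *m u) = 0 by rewrite tr_outer.
have d : dot v (b' - b) = 0 by rewrite dotDr dotNr vb vb' subr0.
have d' : dot u (b' - b) = 0 by rewrite dotDr dotNr ubb' subrr.
rewrite -(addrNK b b') addrC -transvectionM // (sc_mul cP) //.
rewrite conj_outer transvectionV_col // va scale0r subr0 row_transvection //.
rewrite [X in X + _]cocycle_vanish ?add0r //; rewrite !(dotDl, dotZl);
  by rewrite ?va ?ua ?d ?d' ?mulr0 ?addr0.
Qed.

Lemma value_change_row a b u u' v : dot v a = 0 -> dot u a = 0 -> dot u' a = 0 ->
  dot v b = 0 -> dot u b = dot u' b -> c (T b v) (a *m u) = c (T b v) (a *m u').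
Proof.
move=> va ua u'a vb ubb'; apply/eqP; rewrite -subr_eq0 -(scB cP) -mulmxBr.
by rewrite cocycle_vanish // dotDl dotNl ?ua ?u'a ?ubb' subrr.
Qed.

(** For independent [u] and [v], the dual vector [b] supplied by a frame turns
    the relations between root elements into relations between values. *)
Lemma value_frame a u v : a != 0 -> v != 0 -> dot v a = 0 -> dot u a = 0 ->
    (forall k, u != k *: v) ->
  exists b, [/\ dot v b = 0, dot u b = 1,
     forall s, c (T (s *: b) v) (a *m u) = s * c (T b v) (a *m u)
     & c (T b v) (a *m u) = - c (T a u) (b *m v)].
Proof.
move=> a0 v0 va ua uv.
pose i0 : 'I_3 := lshift 1 (ord0 : 'I_2); pose i1 : 'I_3 := lshift 1 (lift ord0 ord0 : 'I_2).
pose i2 : 'I_3 := rshift 2 (ord0 : 'I_1).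
have [||i j|e [f [ef he hf]]] := @complete_frame K n.+1 2 1 (pair_fun v u) (fun=> a).
- exact: row_free2.
- by apply: row_free1; rewrite trmx_eq0.
- by rewrite /pair_fun; case: ifP.
have e0 : e i0 = v by rewrite /i0 he.
have e1 : e i1 = u by rewrite /i1 he.
have f2 : f i2 = a by rewrite /i2 hf.
exists (f i1); rewrite -{1}e0 -{1}e1 !ef; split=> //.
  move=> s; have := @short_root_scale _ _ _ cP _ e f ef i1 i0 i2 isT isT isT s.
  by rewrite /root_elt /frame_unit e0 e1 f2 -transvectionZ scale1r.
have := @short_root_swap _ _ _ cP _ e f ef i1 i0 i2 isT isT isT.
by rewrite /root_elt /frame_unit e0 e1 f2 !scale1r.
Qed.

(** The choices of [b] and [u] for which [transvection b v] moves the flag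
    [u, a] to the flag [u + v, a]. *)
Definition admissible a v b u := [/\ dot v b = 0, dot u b = 1 & dot u a = 0].

Lemma dual_not_prop b u v : dot v b = 0 -> dot u b = 1 -> forall k, u != k *: v.
Proof.
move=> vb ub k; apply/eqP => E; move: ub; rewrite E dotZl vb mulr0 => /eqP.
by rewrite eq_sym oner_eq0.
Qed.

Lemma value_scale a v b u s : dot v a = 0 -> admissible a v b u ->
  c (T (s *: b) v) (a *m u) = s * c (T b v) (a *m u).
Proof.
move=> va [vb ub ua].
have [->|a0] := eqVneq a 0; first by rewrite mul0mx !(sc0 cP) mulr0.
have au : \tr (a *m u) = 0 by rewrite tr_outer.
have [->|v0] := eqVneq v 0; first by rewrite !transvection0r (sc1 cP) // mulr0.
have [b' [vb' ub' hs _]] := value_frame a0 v0 va ua (dual_not_prop vb ub).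
rewrite (@value_change_col a (s *: b) (s *: b')) ?dot_linE ?vb ?vb' ?ub ?ub' ?mulr0 //.
by rewrite hs (@value_change_col a b b') // ub.
Qed.

(** The pair [k^-1 *: b], [k *: u] is admissible with the same value, and for
    [k = u' b] it can be changed to [b'], [u'] one component at a time. *)
Lemma value_link a v b u b' u' : dot v a = 0 -> admissible a v b u ->
  admissible a v b' u' -> dot u' b != 0 ->
  c (T b v) (a *m u) = c (T b' v) (a *m u').
Proof.
move=> va ad [vb' ub' ua']; have [vb ub ua] := ad; set k := dot u' b => k0.
transitivity (c (T (k^-1 *: b) v) (a *m (k *: u))).
  by rewrite -scalemxAr (scZ cP) value_scale // mulrA divff // mul1r.
rewrite (@value_change_row a _ (k *: u) u') ?dot_linE ?ua ?ua' ?vb ?ub ?mulr0 //; last first.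
  by rewrite -/k mulr1 mulVf ?divff.
by apply: value_change_col; rewrite ?dot_linE ?vb ?vb' ?mulr0 // -/k mulVf.
Qed.

(** Either one of the cross pairings is nonzero and [value_link] applies, or
    the sum [u + u'] pairs to [1] with both [b] and [b']. *)
Lemma value_indep a v b u b' u' : dot v a = 0 -> admissible a v b u ->
  admissible a v b' u' -> c (T b v) (a *m u) = c (T b' v) (a *m u').
Proof.
move=> va ad ad'; have [vb ub ua] := ad; have [vb' ub' ua'] := ad'.
have [z|] := eqVneq (dot u' b) 0; last exact: value_link.
have [z'|h] := eqVneq (dot u b') 0; last by symmetry; apply: value_link.
have adu : admissible a v b (u + u') by split; rewrite // dotDl ?ub ?ua ?z ?ua' addr0.
transitivity (c (T b v) (a *m (u + u'))).
  by apply: value_link; rewrite // dotDl ub z addr0 oner_eq0.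
by symmetry; apply: value_link; rewrite // dotDl ub' z' add0r oner_eq0.
Qed.

Lemma admissible_ex a v : exists b u, admissible a v b u.
Proof.
have [u ua uv] := kernel_avoids1 a v N3; have [b vb ub] := separate1 uv.
by exists b, u.
Qed.

(** The form is the common value of [c (1 + b v) (a u)] over admissible
    choices. It is equivariant up to [c] because conjugation preserves
    admissibility, and equivariance under the transvection [1 + b v] itself is
    additivity in [v]. Additivity in [a] is obtained in the same way from the
    dual expression of the value, by a transvection fixing [v]. *)
Lemma cocycle_form : exists m : 'rV[K]_n.+1 -> 'cV[K]_n.+1 -> K^o,
  flag_form m /\
  forall (h : SL n K) v a, dot v a = 0 ->
    m (v *m h) ((h^-1)%g *m a) = m v a + c h (a *m v).
Proof.
pose P (p : 'rV[K]_n.+1 * 'cV[K]_n.+1) (y : K^o) := dot p.1 p.2 = 0 ->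
  forall b u, admissible p.2 p.1 b u -> y = c (T b p.1) (p.2 *m u).
have [p|M MP] := @choice _ _ P.
  have [b [u ad]] := admissible_ex p.2 p.1.
  by exists (c (T b p.1) (p.2 *m u)) => va b' u' ad'; apply: value_indep.
pose m v a := M (v, a).
have mE v a b u : dot v a = 0 -> admissible a v b u -> m v a = c (T b v) (a *m u).
  by move=> va ad; apply: (MP (v, a)).
have m_v0 a : m 0 a = 0.
  have [b [u ad]] := admissible_ex a 0; have [_ _ ua] := ad.
  by rewrite (mE _ _ _ _ _ ad) ?dot0l // transvection0r (sc1 cP) // tr_outer.
have m_a0 v : m v 0 = 0.
  have [b [u ad]] := admissible_ex 0 v.
  by rewrite (mE _ _ _ _ _ ad) ?dot0r // mul0mx (sc0 cP).
have mZl k v a : dot v a = 0 -> m (k *: v) a = k * m v a.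
  move=> va; have [->|k0] := eqVneq k 0; first by rewrite scale0r mul0r m_v0.
  have [b [u ad]] := admissible_ex a v; have [vb ub ua] := ad.
  rewrite (mE v a b u) // (mE _ _ (k^-1 *: b) (k *: u)) ?dot_linE ?va ?mulr0 //.
    by rewrite transvectionZ scalerA mulVf // scale1r -scalemxAr (scZ cP).
  by split; rewrite ?dot_linE ?vb ?ub ?ua ?mulr0 // mulr1 divff.
have mZr k v a : dot v a = 0 -> m v (k *: a) = k * m v a.
  move=> va; have [b [u ad]] := admissible_ex a v; have [vb ub ua] := ad.
  rewrite (mE v a b u) // (mE v _ b u) ?dot_linE ?va ?mulr0 //.
    by rewrite -scalemxAl (scZ cP).
  by split; rewrite ?dot_linE ?ua ?mulr0.
have mH (h : SL n K) v a : dot v a = 0 ->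
    m (v *m h) ((h^-1)%g *m a) = m v a + c h (a *m v).
  move=> va; have [b [u ad]] := admissible_ex a v; have [vb ub ua] := ad.
  have dh w d : dot (w *m h) ((h^-1)%g *m d) = dot w d.
    by rewrite dot_mulmx mulmxA SL_mulV_val mul1mx.
  rewrite (mE v a b u) // (mE _ _ ((h^-1)%g *m b) (u *m h)) ?dh //; last first.
    by split; rewrite dh.
  have := @sc_conj _ _ _ cP (T ((h^-1)%g *m b) (v *m h)) h (T b v) (a *m u).
  rewrite tr_outer !conj_outer transvectionV_col // va scale0r subr0.
  rewrite row_transvection // ub scale1r mulmxDr [a *m u + _]addrC addrK; apply => //.
  apply: val_inj; rewrite /= !val_transvection ?dh //.
  by rewrite mulmxDl mulmxDr mul1mx mulmx1 !mulmxA SL_mulV_val mul1mx.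
(* The dual expression: [transvection a u] moves [v, b] to [v, a + b]. *)
have F1' v a b u : dot v a = 0 -> dot v b = 0 -> dot u a = 0 -> dot u b = - 1 ->
    m v a = c (T a u) (b *m v).
  move=> va vb ua ub.
  have [->|v0] := eqVneq v 0; first by rewrite m_v0 mulmx0 (sc0 cP).
  have [->|a0] := eqVneq a 0.
    by rewrite m_a0 transvection0 (sc1 cP) // tr_outer.
  have uv : forall k, u != k *: v.
    by apply: (@dual_not_prop (- b)); rewrite dotNr ?vb ?ub ?oppr0 ?opprK.
  have [b' [vb' ub' _ sw]] := value_frame a0 v0 va ua uv.
  rewrite (mE v a b' u) // sw; apply/eqP; rewrite eq_sym -addr_eq0 -(scD cP) -mulmxDl.
  by rewrite cocycle_vanish // dotDr ?vb ?vb' ?ub ?ub' ?addr0 // addNr.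
have mDl u v a : dot u a = 0 -> dot v a = 0 -> m (u + v) a = m u a + m v a.
  move=> ua va; have [[k ->]|uv] := proportional_row u v.
    by rewrite -{2}[v]scale1r -scalerDl !mZl // mulrDl mul1r.
  have [b vb ub] := separate1 uv.
  have := mH (T b v) u a ua.
  rewrite row_transvection // ub scale1r transvectionV_col // va scale0r subr0 => ->.
  by rewrite (mE v a b u).
have mDr v a b : dot v a = 0 -> dot v b = 0 -> m v (a + b) = m v a + m v b.
  move=> va vb; have [[k ->]|ab] := proportional_col a b.
    by rewrite -{2}[b]scale1r -scalerDl !mZr // mulrDl mul1r.
  have [w wb wa] := separate1_col ab.
  have := mH (T b (- w)) v a va.
  rewrite row_transvection ?transvectionV_col ?dotNl ?wb ?oppr0 // vb scale0r addr0.
  rewrite wa scaleN1r opprK => ->; congr (_ + _); symmetry; apply: F1' => //.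
    by rewrite dotNl wb oppr0.
  by rewrite dotNl wa.
exists m; split=> //; split=> [k u v a ua va|k v a b va vb].
  by rewrite mDl ?dotZl ?ua ?mulr0 // mZl.
by rewrite mDr ?dotZr ?va ?mulr0 // mZr.
Qed.

End CocycleForm.

(** * Flags and lines in coordinates *)
Section Annihilators.
Variables (K : fieldType) (N : nat).
Implicit Types (S : {vspace 'rV[K]_N}).

Lemma annihilator S : exists r (C : 'M[K]_(N, r)),
  [/\ (r + \dim S = N)%N, row_free C^T & forall w, (w \in S) = (w *m C == 0)].
Proof.
pose B := \matrix_(i < \dim S) (vbasis S)`_i.
have wB w : (w \in S) = (w <= B)%MS.
  apply/idP/submxP => [wS|[D ->]].
    exists (\row_i coord (vbasis S) i w); rewrite mulmx_sum_row {1}(coord_vbasis wS).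
    by apply: eq_bigr => i _; rewrite mxE rowK.
  rewrite mulmx_sum_row; apply: memv_suml => i _; rewrite rowK memvZ //.
  by apply: vbasis_mem; rewrite mem_nth // size_tuple.
have rB : \rank B = \dim S.
  apply/eqP; rewrite -/(row_free B); apply: inj_row_free => x.
  rewrite mulmx_sum_row => H; apply/rowP => i; rewrite mxE.
  have /freeP := basis_free (vbasisP S); apply.
  by rewrite -[RHS]H; apply: eq_bigr => j _; rewrite rowK.
exists (\rank (cokermx B)), (col_base (cokermx B)); split.
- by rewrite mxrank_coker rB subnK // -rB rank_leq_col.
- by rewrite /row_free mxrank_tr; apply: col_base_full.
move=> w; rewrite wB submxE -{1}(mulmx_base (cokermx B)) mulmxA.
apply/eqP/eqP => [h|->]; last by rewrite mul0mx.
by apply: (row_free_inj (row_base_free (cokermx B))); rewrite /= h mul0mx.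
Qed.

(** The left inverse of [C] splits every row into a combination of [C] and a
    row that [C] kills. *)
Lemma annihilated_col r (C : 'M[K]_(N, r)) (a : 'cV_N) : row_free C^T ->
  (forall w : 'rV_N, w *m C = 0 -> w *m a = 0) -> exists y, a = C *m y.
Proof.
move=> /row_freeP[D CD] h.
have DC : D^T *m C = 1%:M by rewrite -[C]trmxK -trmx_mul CD trmx1.
exists (D^T *m a); apply/eqP; rewrite mulmxA -subr_eq0; apply/eqP.
rewrite -[X in X - _]mul1mx -mulmxBl; apply/row_matrixP => i; rewrite row_mul row0.
by apply: h; rewrite -row_mul mulmxBl mul1mx -mulmxA DC mulmx1 subrr row0.
Qed.

Lemma dim_kernel_col (a : 'cV[K]_N) : a != 0 ->
  (\dim (lker (linfun (mulmxr a : 'rV_N -> 'rV_1))) + 1 = N)%N.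
Proof.
move=> a0; set f := linfun _.
have := limg_ker_dim f fullv; rewrite capfv dimvf /dim /= mul1n.
move=> H; apply: etrans H; congr (_ + _)%N; apply/eqP; rewrite eq_sym eqn_leq; apply/andP; split.
  by apply: leq_trans (dimvS (subvf _)) _; rewrite dimvf /dim /= mul1n.
have [u ua] := dual_col a0.
rewrite lt0n dimv_eq0; apply: contraTneq (memv_img f (memvf u)) => ->.
by rewrite memv0 lfunE /= dot_eq0 ua oner_eq0.
Qed.

End Annihilators.

Section Flags.
Variables (n : nat) (K : fieldType).
Implicit Types (x y : flag n K) (u v w : 'rV[K]_n.+1) (a b : 'cV[K]_n.+1).

Definition represents x v a :=
  flag_pt x = <[v]>%VS /\ forall w, (w \in flag_hyp x) = (w *m a == 0).

Lemma rep_spec x v a : represents x v a -> [/\ v != 0, a != 0 & dot v a = 0].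
Proof.
case=> px hx; split.
- by have := flag_dim_pt x; rewrite px dim_vline; case: (v != 0).
- apply/eqP => a0; have := flag_dim_hyp x.
  have -> : flag_hyp x = fullv by apply/vspaceP => w; rewrite hx a0 mulmx0 eqxx memvf.
  by rewrite dimvf /dim /= mul1n => /eqP; rewrite eqn_leq ltnn.
- apply/eqP; rewrite -dot_eq0 -hx; apply: (subvP (flag_incident x)).
  by rewrite px memv_line.
Qed.

Lemma rep_ex v a : v != 0 -> a != 0 -> dot v a = 0 -> exists x, represents x v a.
Proof.
move=> v0 a0 va.
pose H := lker (linfun (mulmxr a : 'rV[K]_n.+1 -> 'rV_1)).
have wH w : (w \in H) = (w *m a == 0) by rewrite memv_ker lfunE.
have dp : \dim <[v]> = 1%N by rewrite dim_vline v0.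
have dH : \dim H = n by have := dim_kernel_col a0; rewrite addn1 => -[].
have pH : (<[v]> <= H)%VS by rewrite -memvE wH dot_eq0 va.
by exists (Flag dp dH pH).
Qed.

Lemma flag_eq x y : flag_pt x = flag_pt y -> flag_hyp x = flag_hyp y -> x = y.
Proof.
case: x y => [p H d1 d2 d3] [p' H' d1' d2' d3'] /= E E'.
by subst p' H'; congr Flag; apply: Prop_irrelevance.
Qed.

Lemma rep_uniq x y v a : represents x v a -> represents y v a -> x = y.
Proof.
move=> [px hx] [py hy]; apply: flag_eq; first by rewrite px py.
by apply/vspaceP => w; rewrite hx hy.
Qed.

Lemma rep_exists x : exists v a, represents x v a.
Proof.
have [v px] : exists v, flag_pt x = <[v]>%VS.
  exists (vpick (flag_pt x)); apply/eqP; rewrite eq_sym eqEdim -memvE memv_pick /=.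
  by rewrite flag_dim_pt dim_vline vpick0 -dimv_eq0 flag_dim_pt.
have [r [C [hr _ hC]]] := annihilator (flag_hyp x).
have r1 : r = 1%N by apply: (@addIn n); rewrite -[in LHS](flag_dim_hyp x) hr.
subst r.
by exists v, C.
Qed.

Lemma rep_scale x v a k k' : k != 0 -> k' != 0 ->
  represents x v a -> represents x (k *: v) (k' *: a).
Proof.
move=> k0 k'0 [px hx]; split.
  rewrite px; apply/eqP; rewrite eqEdim -!memvE !dim_vline scaler_eq0 (negbTE k0) leqnn andbT.
  by apply/vlineP; exists k^-1; rewrite scalerA mulVf // scale1r.
by move=> w; rewrite hx -scalemxAr scaler_eq0 (negbTE k'0).
Qed.

Lemma rep_proportional x v a v' a' : represents x v a -> represents x v' a' ->
  exists k k', [/\ k != 0, k' != 0, v' = k *: v & a' = k' *: a].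
Proof.
move=> R R'; have [px hx] := R; have [px' hx'] := R'.
have [v0 a0 _] := rep_spec R; have [v0' a0' _] := rep_spec R'.
have /vlineP[k kv] : v' \in <[v]>%VS by rewrite -px px' memv_line.
have [||y ya] := @annihilated_col K n.+1 1 a a'.
- by rewrite /row_free rank_rV trmx_eq0 a0.
- by move=> w /eqP; rewrite -hx hx' => /eqP.
exists k, (y 0 0); split=> //.
- by apply: contraNneq v0' => k0; rewrite kv k0 scale0r.
- apply: contraNneq a0' => y0.
  by rewrite ya [y]mx11_scalar y0 mul_mx_scalar scale0r.
- by rewrite ya {1}[y]mx11_scalar mul_mx_scalar.
Qed.

Lemma outer_neq0 v a : v != 0 -> a != 0 -> a *m v != 0.
Proof.
move=> v0 a0; have [u ua] := dual_col a0.
apply: contraNneq v0 => av; rewrite -[v]scale1r -ua -row_outer av mulmx0.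
by [].
Qed.

(** The rank one matrix determines its row and column spaces, hence the flag. *)
Lemma outer_rep x y v a v' a' k : represents x v a -> represents y v' a' ->
  k != 0 -> a' *m v' = k *: (a *m v) -> x = y.
Proof.
move=> R R' k0 E.
have [v0 a0 _] := rep_spec R; have [v0' a0' _] := rep_spec R'.
have [u ua] := dual_col a0; have [b vb] := dual_vec v0.
have ev : dot u a' *: v' = k *: v.
  by rewrite -row_outer E -scalemxAr row_outer ua scale1r.
have ea : dot v' b *: a' = k *: a.
  by rewrite -outer_col E -scalemxAl outer_col vb scale1r.
have kv0 : k *: v != 0 by rewrite scaler_eq0 negb_or k0.
have ka0 : k *: a != 0 by rewrite scaler_eq0 negb_or k0.
have u0 : dot u a' != 0 by apply: contraNneq kv0 => z; rewrite -ev z scale0r.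
have b0 : dot v' b != 0 by apply: contraNneq ka0 => z; rewrite -ea z scale0r.
apply: (@rep_uniq x y (k *: v) (k *: a)); first exact: rep_scale.
by rewrite -ev -ea; apply: rep_scale.
Qed.

Lemma nat_embeddingE x v a t : represents x v a ->
  nat_embedding x t <-> exists k, adj_val t = k *: (a *m v).
Proof.
move=> R; split=> [[v' [a' [k [px hx ht]]]]|[k ht]]; last first.
  by case: R => px hx; exists v, a, k.
have [l [l' [_ _ ev ea]]] := rep_proportional R (conj px hx).
by exists (k * (l' * l)); rewrite ht ev ea -scalemxAl -scalemxAr !scalerA mulrA.
Qed.

End Flags.

Definition independent2 (K : fieldType) (V : lmodType K) (p q : V) :=
  forall c d : K, c *: p + d *: q = 0 -> c = 0 /\ d = 0.

Lemma independent2_neq (K : fieldType) (V : lmodType K) (p q : V) k :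
  independent2 p q -> p != k *: q.
Proof.
move=> h; apply/eqP => E; have [|/eqP] := h 1 (- k); last by rewrite oner_eq0.
by rewrite scale1r scaleNr E addrN.
Qed.

Lemma neq_independent2 (K : fieldType) (V : lmodType K) (p q : V) :
  q != 0 -> (forall k, p != k *: q) -> independent2 p q.
Proof.
move=> q0 pq c d H; have c0 : c = 0.
  apply/eqP/negPn/negP => c0; case/eqP: (pq (- (d / c))).
  apply: (scalerI c0); rewrite scalerA mulrN mulrCA divff // mulr1 scaleNr.
  by apply/eqP; rewrite -addr_eq0 H.
split=> //; move: H; rewrite c0 scale0r add0r => /eqP.
by rewrite scaler_eq0 (negbTE q0) orbF => /eqP.
Qed.

Lemma independent2C (K : fieldType) (V : lmodType K) (p q : V) :
  independent2 p q -> independent2 q p.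
Proof. by move=> h c d; rewrite addrC => /h[]. Qed.

Section Lines.
Variables (n : nat) (K : fieldType).
Implicit Types (x y : flag n K) (u v w : 'rV[K]_n.+1) (a b : 'cV[K]_n.+1).

Lemma span2P v v' w : w \in <<[:: v; v']>>%VS <-> exists c d, w = c *: v + d *: v'.
Proof.
rewrite span_cons span_seq1; split.
  by case/memv_addP=> _ /vlineP[c ->] [_ /vlineP[d ->] ->]; exists c, d.
by case=> c [d ->]; apply: memv_add; apply/vlineP; [exists c|exists d].
Qed.

Lemma common_line_rows x y z v v' a : independent2 v v' ->
  represents x v a -> represents y v' a -> represents z (v + v') a ->
  exists l, [/\ flag_line l, l x, l y & l z].
Proof.
move=> vv' [px hx] [py hy] [pz hz].
have v'0 : v' != 0.
  apply/eqP => v'0; have [|_ /eqP] := vv' 0 1; last by rewrite oner_eq0.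
  by rewrite scale0r scale1r add0r.
have inL k k' : (<[k *: v + k' *: v']> <= <<[:: v; v']>>)%VS.
  by rewrite -memvE; apply/span2P; exists k, k'.
exists (line_LH <<[:: v; v']>>%VS (flag_hyp x)); split.
- right; exists <<[:: v; v']>>%VS, (flag_hyp x); split=> //.
  + have /eqP-> // : free [:: v; v'].
    rewrite free_cons span_seq1 seq1_free v'0 andbT.
    by apply/vlineP => -[k E]; case/eqP: (independent2_neq k vv').
  + exact: flag_dim_hyp.
  apply/subvP => w /span2P[c [d ->]]; apply: memvD; apply: memvZ.
    by apply: (subvP (flag_incident x)); rewrite px memv_line.
  have -> : flag_hyp x = flag_hyp y by apply/vspaceP => w'; rewrite hx hy.
  by apply: (subvP (flag_incident y)); rewrite py memv_line.
- by split=> //=; rewrite px; have := inL 1 0; rewrite scale1r scale0r addr0.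
- split=> /=; first by rewrite py; have := inL 0 1; rewrite scale1r scale0r add0r.
  by apply/vspaceP => w'; rewrite hx hy.
split=> /=; first by rewrite pz; have := inL 1 1; rewrite !scale1r.
by apply/vspaceP => w'; rewrite hx hz.
Qed.

Lemma common_line_cols x y z v a a' : independent2 a a' ->
  represents x v a -> represents y v a' -> represents z v (a + a') ->
  exists l, [/\ flag_line l, l x, l y & l z].
Proof.
move=> aa' [px hx] [py hy] [pz hz].
pose S := (flag_hyp x :&: flag_hyp y)%VS.
exists (line_pS (flag_pt x) S); split.
- left; exists (flag_pt x), S; split=> //.
  + exact: flag_dim_pt.
  + have := dimv_sum_cap (flag_hyp x) (flag_hyp y); rewrite !flag_dim_hyp -/S.
    suff -> : \dim (flag_hyp x + flag_hyp y) = n.+1.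
      by rewrite addSn -addnS => /addnI E; rewrite addn2 E.
    have [u ua ua'] := separate1_col (fun k => independent2_neq k (independent2C aa')).
    apply/eqP; rewrite eqn_leq; apply/andP; split.
      by apply: leq_trans (dimvS (subvf _)) _; rewrite dimvf /dim /= mul1n.
    rewrite ltnNge; apply/negP => h.
    have : flag_hyp y == (flag_hyp x + flag_hyp y)%VS.
      by rewrite eqEdim addvSr flag_dim_hyp.
    move/eqP => E; have : u \in flag_hyp y.
      by rewrite E; apply: (subvP (addvSl _ _)); rewrite hx dot_eq0 ua.
    by rewrite hy dot_eq0 ua' oner_eq0.
  + by rewrite subv_cap flag_incident px -py flag_incident.
- by split=> //=; apply: capvSl.
- by split=> /=; [rewrite px py|apply: capvSr].
split=> /=; first by rewrite px pz.
apply/subvP => w; rewrite memv_cap hx hy hz mulmxDr => /andP[/eqP-> /eqP->].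
by rewrite addr0.
Qed.

Definition row_line (l : set (flag n K)) := exists v v' a,
  [/\ independent2 v v', a != 0, dot v a = 0 /\ dot v' a = 0
    & forall x, l x <-> exists c d, represents x (c *: v + d *: v') a].

Definition col_line (l : set (flag n K)) := exists v a a',
  [/\ independent2 a a', v != 0, dot v a = 0 /\ dot v a' = 0
    & forall x, l x <-> exists c d, represents x v (c *: a + d *: a')].

Lemma ord2P (i : 'I_2) : i = ord0 \/ i = lift ord0 ord0.
Proof. by case: i => [[|[|//]] h]; [left|right]; apply: val_inj. Qed.

Lemma flag_line_cases l : flag_line l -> row_line l \/ col_line l.
Proof.
case=> [[p [S [dp dS pS ->]]]|[L [H [dL dH LH ->]]]]; [right|left].
  have [v pv] : exists v, p = <[v]>%VS.
    exists (vpick p); apply/eqP; rewrite eq_sym eqEdim -memvE memv_pick /=.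
    by rewrite dp dim_vline vpick0 -dimv_eq0 dp.
  have [r [C [hr Cfree hC]]] := annihilator S.
  have r2 : r = 2%N by apply: (@addIn (\dim S)); apply: etrans hr _; rewrite addnC; symmetry.
  subst r.
  have CE (y : 'cV[K]_2) :
      C *m y = y ord0 0 *: col ord0 C + y (lift ord0 ord0) 0 *: col (lift ord0 ord0) C.
    apply/colP => i; rewrite !mxE !big_ord_recl big_ord0 addr0.
    by rewrite !(mulrC (y _ _)).
  have SC w : w \in S = (dot w (col ord0 C) == 0) && (dot w (col (lift ord0 ord0) C) == 0).
    rewrite hC; have dC j : dot w (col j C) = (w *m C) 0 j.
      by rewrite /dot colE mulmxA -colE mxE.
    rewrite !dC; apply/eqP/andP => [->|[/eqP h0 /eqP h1]]; first by rewrite !mxE.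
    by apply/rowP => i; rewrite [RHS]mxE; case: (ord2P i) => ->.
  exists v, (col ord0 C), (col (lift ord0 ord0) C); split.
  + move=> c d E; pose y : 'cV[K]_2 := \col_i pair_fun c d i.
    have Cy : C *m y = 0 by rewrite CE !mxE.
    have y0 : y = 0.
      apply: trmx_inj; apply: (row_free_inj Cfree).
      by rewrite /= -trmx_mul Cy !trmx0 mul0mx.
    move/colP: y0 => y0; split.
      by have := y0 ord0; rewrite !mxE.
    by have := y0 (lift ord0 ord0); rewrite !mxE.
  + by have := dim_vline v; rewrite -pv dp; case: (v != 0).
  + by have : v \in S; [rewrite (subvP pS) // pv memv_line | rewrite SC => /andP[/eqP-> /eqP->]].
  move=> x; split=> [[px Sx]|[c [d R]]].
    have [v' [a R]] := rep_exists x.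
    have [|y ya] := @annihilated_col _ _ _ C a Cfree.
      by move=> w /eqP; rewrite -hC => /(subvP Sx); case: R => _ -> /eqP.
    exists (y ord0 0), (y (lift ord0 ord0) 0); rewrite -CE -ya.
    by case: R => _ hx; split; rewrite // px.
  case: (R) => px hx; split; first by rewrite px pv.
  apply/subvP => w; rewrite SC => /andP[/eqP h0 /eqP h1].
  by rewrite hx dot_eq0 !dot_linE h0 h1 !mulr0 addr0.
have [r [a [hr afree ha]]] := annihilator H.
have r1 : r = 1%N by apply: (@addIn (\dim H)); apply: etrans hr _; rewrite dH.
subst r.
have a0 : a != 0.
  by rewrite -trmx_eq0; move: afree; rewrite /row_free rank_rV; case: (a^T != 0).
have [v [v' [Lvv' vv']]] : exists v v', L = <<[:: v; v']>>%VS /\ independent2 v v'.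
  have := span_basis (vbasisP L); have := basis_free (vbasisP L).
  have := size_tuple (vbasis L); rewrite [X in _ = X]dL.
  case: (tval (vbasis L)) => [|v [|v' [|//]]] // _ hfree hL.
  exists v, v'; split=> //; move: hfree; rewrite free_cons span_seq1 seq1_free.
  case/andP=> h v'0; apply: neq_independent2 => // k.
  by apply: contra h => /eqP ->; apply/vlineP; exists k.
have LHv w : w \in L -> dot w a = 0.
  by move=> /(subvP LH); rewrite ha dot_eq0 => /eqP.
exists v, v', a; split=> //.
  by split; apply: LHv; rewrite Lvv'; apply/span2P; [exists 1, 0|exists 0, 1];
    rewrite scale1r scale0r ?addr0 ?add0r.
move=> x; split=> [[pL hH]|[c [d [px hx]]]].
  have [v1 [a1 [px hx]]] := rep_exists x.
  have /span2P[c [d E]] : v1 \in <<[:: v; v']>>%VS.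
    by rewrite -Lvv' (subvP pL) // px memv_line.
  by exists c, d; rewrite -E; split=> // w; rewrite hH ha.
split.
  by rewrite px -memvE Lvv'; apply/span2P; exists c, d.
by apply/vspaceP => w; rewrite hx ha.
Qed.

End Lines.

(** * Spans and traceless matrices *)
Section Span.
Variables (K : fieldType) (W : lmodType K) (X : set W).

Definition span_pred : {pred W} := fun u =>
  `[< forall U : {pred W}, submod_closed U -> (forall x, X x -> x \in U) -> u \in U >].

Fact span_submod_closed : submod_closed span_pred.
Proof.
split=> [|k u v]; rewrite !unfold_in.
  by apply/asboolP => U [U0 _] _.
move=> /asboolP uX /asboolP vX; apply/asboolP => U UP XU.
by have [_ UP'] := UP; apply: UP'; [apply: uX|apply: vX].
Qed.

HB.instance Definition _ := GRing.isSubmodClosed.Build K W span_pred span_submod_closed.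

Record span_mod := SpanMod { span_val :> W; _ : span_val \in span_pred }.
HB.instance Definition _ := [isSub for span_val].
HB.instance Definition _ := [Choice of span_mod by <:].
HB.instance Definition _ := [SubChoice_isSubLmodule of span_mod by <:].

Lemma mem_span x : X x -> x \in span_pred.
Proof. by move=> Xx; apply/asboolP => U _; apply. Qed.

Lemma span_generated (U : {pred span_mod}) : submod_closed U ->
  (forall x (xX : X x), SpanMod (mem_span xX) \in U) -> forall u, u \in U.
Proof.
move=> [U0 UP] XU; pose U' : {pred W} := fun x =>
  `[< exists2 y : span_mod, span_val y = x & y \in U >].
have hU' : submod_closed U'.
  split=> [|k x y]; rewrite !unfold_in; first by apply/asboolP; exists 0.
  move=> /asboolP[x' <- x'U] /asboolP[y' <- y'U]; apply/asboolP.
  by exists (k *: x' + y') => //; apply: UP.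
case=> u hu; have /asboolP/(_ U' hU') := hu.
have XU' x : X x -> x \in U'.
  by move=> xX; apply/asboolP; exists (SpanMod (mem_span xX)).
by move=> /(_ XU')/asboolP[y yu yU]; have <- : y = SpanMod hu by apply: val_inj.
Qed.

End Span.

Section Traceless.
Variables (n : nat) (K : fieldType).
Implicit Types (v : 'rV[K]_n.+1) (a : 'cV[K]_n.+1).

Definition to_adjoint (m : 'M[K]_n.+1) : adjoint n K := insubd 0 m.

Lemma val_to_adjoint m : \tr m = 0 -> adj_val (to_adjoint m) = m.
Proof. by move=> m0; rewrite insubdK //; apply/eqP. Qed.

Lemma adj_valD (s t : adjoint n K) : adj_val (s + t) = adj_val s + adj_val t.
Proof. by []. Qed.

Lemma adj_valZ k (s : adjoint n K) : adj_val (k *: s) = k *: adj_val s.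
Proof. by []. Qed.

Lemma adj_inj (s t : adjoint n K) : adj_val s = adj_val t -> s = t.
Proof. exact: val_inj. Qed.

Lemma tr_adj (s : adjoint n K) : \tr (adj_val s) = 0.
Proof. by case: s => s h; apply/eqP; exact: h. Qed.

End Traceless.

(** * The vectors of a cover above rank one matrices *)
Section Vectors.
Variables (n : nat) (K : fieldType) (Ahat : lmodType K).
Variables (ehat : flag_geometry n K -> set Ahat) (phi : {linear Ahat -> adjoint n K}).
Hypotheses (n2 : (2 <= n)%N) (ehatP : is_embedding ehat).
Hypothesis phiP : projects phi ehat (@nat_embedding n K).
Implicit Types (x y z : flag n K) (v : 'rV[K]_n.+1) (a : 'cV[K]_n.+1).

Let N3 : (2 < n.+1)%N. Proof. by []. Qed.

Lemma phi_valZ k u : adj_val (phi (k *: u)) = k *: adj_val (phi u).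
Proof. by rewrite linearZ. Qed.

(** The value is [0] when [v] or [a] vanishes, since no flag is represented
    then; this keeps [flag_vec] linear. *)
Definition flag_vec v a : Ahat := xget 0 [set u |
  (exists2 x, represents x v a & ehat x u) /\ adj_val (phi u) = a *m v].

Lemma flag_vecP x v a : represents x v a ->
  ehat x (flag_vec v a) /\ adj_val (phi (flag_vec v a)) = a *m v.
Proof.
move=> R; have [v0 a0 va] := rep_spec R.
have : nat_embedding x (to_adjoint (a *m v)).
  apply/(nat_embeddingE _ R); exists 1.
  by rewrite scale1r val_to_adjoint // tr_outer.
rewrite -(phiP x) => -[u xu phiu].
have [|[y Ry yw] hw] := @xgetPex _ 0 [set u |
  (exists2 x, represents x v a & ehat x u) /\ adj_val (phi u) = a *m v].
  exists u; split; first by exists x.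
  by rewrite phiu val_to_adjoint // tr_outer.
by rewrite -(rep_uniq Ry R).
Qed.

Lemma ehat_vec x v a u : represents x v a -> ehat x u <-> exists k, u = k *: flag_vec v a.
Proof.
move=> R; have [xw hw] := flag_vecP R; have [v0 a0 _] := rep_spec R.
have [/(_ x)[p p0 E] _ _ _] := ehatP; rewrite E in xw *.
have [k wk] := xw.
have k0 : k != 0.
  apply/eqP => k0; move/eqP: (outer_neq0 v0 a0).
  by rewrite -hw wk k0 scale0r linear0.
split=> [[l ->]|[l ->]]; last by exists (l * k); rewrite wk scalerA.
by exists (l / k); rewrite wk scalerA divfK.
Qed.

Lemma flag_vec_eq x v a u : represents x v a -> ehat x u ->
  adj_val (phi u) = a *m v -> u = flag_vec v a.
Proof.
move=> R /(ehat_vec _ R)[k ->] E; have [_ hw] := flag_vecP R.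
have [v0 a0 _] := rep_spec R.
move: E; rewrite phi_valZ hw => /eqP.
rewrite -{2}[a *m v]scale1r -subr_eq0 -scalerBl scaler_eq0 (negbTE (outer_neq0 v0 a0)) orbF.
by rewrite subr_eq0 => /eqP ->; rewrite scale1r.
Qed.

Lemma flag_vec0 v a : v = 0 \/ a = 0 -> flag_vec v a = 0.
Proof.
move=> h; apply: xgetPN => u [[x /rep_spec[v0 a0 _] _] _].
by case: h => E; [move: v0|move: a0]; rewrite E eqxx.
Qed.

Lemma flag_vec0l a : flag_vec 0 a = 0. Proof. by apply: flag_vec0; left. Qed.
Lemma flag_vec0r v : flag_vec v 0 = 0. Proof. by apply: flag_vec0; right. Qed.

Lemma phi_flag_vec v a : dot v a = 0 -> adj_val (phi (flag_vec v a)) = a *m v.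
Proof.
move=> va; have [->|v0] := eqVneq v 0; first by rewrite flag_vec0l linear0 mulmx0.
have [->|a0] := eqVneq a 0; first by rewrite flag_vec0r linear0 mul0mx.
by have [x R] := rep_ex v0 a0 va; have [] := flag_vecP R.
Qed.

Lemma flag_vecZl k v a : dot v a = 0 -> flag_vec (k *: v) a = k *: flag_vec v a.
Proof.
move=> va; have [->|v0] := eqVneq v 0; first by rewrite scaler0 !flag_vec0l scaler0.
have [->|a0] := eqVneq a 0; first by rewrite !flag_vec0r scaler0.
have [->|k0] := eqVneq k 0; first by rewrite !scale0r flag_vec0l.
have [x R] := rep_ex v0 a0 va; have R' := rep_scale k0 (oner_neq0 K) R.
rewrite scale1r in R'; symmetry; apply: (flag_vec_eq R').
  by apply/(ehat_vec _ R); exists k.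
by rewrite phi_valZ phi_flag_vec // scalemxAr.
Qed.

Lemma flag_vecZr k v a : dot v a = 0 -> flag_vec v (k *: a) = k *: flag_vec v a.
Proof.
move=> va; have [->|v0] := eqVneq v 0; first by rewrite !flag_vec0l scaler0.
have [->|a0] := eqVneq a 0; first by rewrite scaler0 !flag_vec0r scaler0.
have [->|k0] := eqVneq k 0; first by rewrite !scale0r flag_vec0r.
have [x R] := rep_ex v0 a0 va; have R' := rep_scale (oner_neq0 K) k0 R.
rewrite scale1r in R'; symmetry; apply: (flag_vec_eq R').
  by apply/(ehat_vec _ R); exists k.
by rewrite phi_valZ phi_flag_vec // scalemxAl.
Qed.

(** The images of the points of a line lie in a plane, on which [phi] is
    injective because the images of two points remain independent; the
    relation between the images by [phi] therefore lifts. *)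
Lemma line_add l x y z (ux uy uz : Ahat) : flag_line l -> l x -> l y -> l z ->
    ehat x ux -> ehat y uy -> ehat z uz ->
    independent2 (phi ux) (phi uy) -> phi uz = phi ux + phi uy ->
  uz = ux + uy.
Proof.
move=> ll lx ly lz xu yu zu ind E.
have [_ _ /(_ l ll)[p [q [_ El]]] _] := ehatP.
have inspan t u : l t -> ehat t u -> exists c d : K, u = c *: p + d *: q.
  move=> lt tu; have : (ehat @` l) (ehat t) by exists t.
  by rewrite El => -[_]; apply.
have [a1 [b1 e1]] := inspan _ _ lx xu.
have [a2 [b2 e2]] := inspan _ _ ly yu.
have [a3 [b3 e3]] := inspan _ _ lz zu.
pose D := a1 * b2 - a2 * b1.
have cramer c d : (c * b2 - a2 * d) *: ux + (a1 * d - c * b1) *: uy =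
    D *: (c *: p + d *: q).
  rewrite e1 e2 !scalerDr !scalerA addrACA -!scalerDl; congr (_ *: _ + _ *: _);
    rewrite /D; ring.
have D0 : D != 0.
  apply/eqP => D0.
  have h c d : c * b2 - a2 * d = 0 /\ a1 * d - c * b1 = 0.
    by apply: ind; rewrite -!linearZ -linearD /= cramer D0 scale0r linear0.
  have [/eqP b20 /eqP b10] := h 1 0; have [/eqP a20 /eqP a10] := h 0 1.
  move: b20 b10 a20 a10; rewrite !mul1r !mul0r !mulr0 !mulr1 !subr0 !sub0r !oppr_eq0.
  move=> _ /eqP b10 _ /eqP a10; have [|/eqP] := ind 1 0; last by rewrite oner_eq0.
  have -> : ux = 0 by rewrite e1 a10 b10 !scale0r addr0.
  by rewrite linear0 scaler0 scale0r addr0.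
have := cramer a3 b3; rewrite -e3 => C.
have /(congr1 phi) := C; rewrite linearD !linearZ /= E => P.
have [] := ind (a3 * b2 - a2 * b3 - D) (a1 * b3 - a3 * b1 - D).
  by rewrite !(scalerBl _ D) addrACA P -opprD -scalerDr subrr.
move=> /subr0_eq h1 /subr0_eq h2; apply: (scalerI D0).
by rewrite -C h1 h2 scalerDr.
Qed.

Lemma independent_phi (v v' : 'rV[K]_n.+1) (a a' : 'cV[K]_n.+1) :
    dot v a = 0 -> dot v' a' = 0 ->
    (forall c d : K, c *: (a *m v) + d *: (a' *m v') = 0 -> c = 0 /\ d = 0) ->
  independent2 (phi (flag_vec v a)) (phi (flag_vec v' a')).
Proof.
move=> va va' h c d /(congr1 (@adj_val n K)).
by rewrite adj_valD !adj_valZ !phi_flag_vec // => /h.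
Qed.

Lemma flag_vecDl v v' a : dot v a = 0 -> dot v' a = 0 ->
  flag_vec (v + v') a = flag_vec v a + flag_vec v' a.
Proof.
move=> va va'; have [->|a0] := eqVneq a 0; first by rewrite !flag_vec0r addr0.
have [[k ->]|vv'] := proportional_row v v'.
  by rewrite -{2}[v']scale1r -scalerDl !flag_vecZl // scalerDl scale1r.
have [v0'|v'0] := eqVneq v' 0; first by rewrite v0' flag_vec0l !addr0.
have v0 : v != 0 by have := vv' 0; rewrite scale0r.
have vaD : dot (v + v') a = 0 by rewrite dotDl va va' addr0.
have vD0 : v + v' != 0 by have := vv' (-1); rewrite scaleN1r -addr_eq0.
have ind := neq_independent2 v'0 vv'.
have [x Rx] := rep_ex v0 a0 va; have [y Ry] := rep_ex v'0 a0 va'.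
have [z Rz] := rep_ex vD0 a0 vaD.
have [l [ll lx ly lz]] := common_line_rows ind Rx Ry Rz.
have [xu _] := flag_vecP Rx; have [yu _] := flag_vecP Ry; have [zu _] := flag_vecP Rz.
apply: (line_add ll lx ly lz xu yu zu).
  apply: independent_phi => // c d; rewrite !scalemxAr -mulmxDr => E; apply: ind.
  apply/eqP; apply: contraTT isT => h; move/eqP: (outer_neq0 h a0); by rewrite E.
by apply: adj_inj; rewrite adj_valD !phi_flag_vec // mulmxDr.
Qed.

Lemma flag_vecDr v a a' : dot v a = 0 -> dot v a' = 0 ->
  flag_vec v (a + a') = flag_vec v a + flag_vec v a'.
Proof.
move=> va va'; have [->|v0] := eqVneq v 0; first by rewrite !flag_vec0l addr0.
have [[k ->]|aa'] := proportional_col a a'.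
  by rewrite -{2}[a']scale1r -scalerDl !flag_vecZr // scalerDl scale1r.
have [a0'|a'0] := eqVneq a' 0; first by rewrite a0' flag_vec0r !addr0.
have a0 : a != 0 by have := aa' 0; rewrite scale0r.
have vaD : dot v (a + a') = 0 by rewrite dotDr va va' addr0.
have aD0 : a + a' != 0 by have := aa' (-1); rewrite scaleN1r -addr_eq0.
have ind := neq_independent2 a'0 aa'.
have [x Rx] := rep_ex v0 a0 va; have [y Ry] := rep_ex v0 a'0 va'.
have [z Rz] := rep_ex v0 aD0 vaD.
have [l [ll lx ly lz]] := common_line_cols ind Rx Ry Rz.
have [xu _] := flag_vecP Rx; have [yu _] := flag_vecP Ry; have [zu _] := flag_vecP Rz.
apply: (line_add ll lx ly lz xu yu zu).
  apply: independent_phi => // c d; rewrite !scalemxAl -mulmxDl => E; apply: ind.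
  apply/eqP; apply: contraTT isT => h; move/eqP: (outer_neq0 v0 h); by rewrite E.
by apply: adj_inj; rewrite adj_valD !phi_flag_vec // mulmxDl.
Qed.

Lemma flag_vec_form : flag_form flag_vec.
Proof.
split=> k.
  by move=> u v a ua va; rewrite flag_vecDl ?dotZl ?ua ?mulr0 // flag_vecZl.
by move=> v a b va vb; rewrite flag_vecDr ?dotZr ?va ?mulr0 // flag_vecZr.
Qed.

Lemma flag_vec_span (U : {pred Ahat}) : submod_closed U ->
  (forall v a, dot v a = 0 -> flag_vec v a \in U) -> forall u, u \in U.
Proof.
move=> UP h; have [_ _ _ /(_ U UP)] := ehatP; apply=> x u.
have [v [a R]] := rep_exists x; have [_ _ va] := rep_spec R.
case/(ehat_vec _ R) => k ->; have [U0 UL] := UP.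
by rewrite -[_ *: _]addr0; apply: UL => //; apply: h.
Qed.

End Vectors.

(** * The embedding defined by a flag form *)
Lemma linear_ex (K : fieldType) (U V : lmodType K) (f : U -> V) :
  linear f -> exists g : {linear U -> V}, g =1 f.
Proof.
move=> lf; pose mix := GRing.isLinear.Build K U V _ f lf.
by exists (HB.pack f mix : {linear U -> V}).
Qed.

Section FlagFormTheory.
Variables (n : nat) (K : fieldType) (V : lmodType K).
Variable m : 'rV[K]_n.+1 -> 'cV[K]_n.+1 -> V.
Hypothesis mP : flag_form m.
Implicit Types (v : 'rV[K]_n.+1) (a : 'cV[K]_n.+1).

Lemma flag_formDl u v a : dot u a = 0 -> dot v a = 0 -> m (u + v) a = m u a + m v a.
Proof. by move=> ua va; have := mP.1 1 u v a ua va; rewrite !scale1r. Qed.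
Lemma flag_formDr v a b : dot v a = 0 -> dot v b = 0 -> m v (a + b) = m v a + m v b.
Proof. by move=> va vb; have := mP.2 1 v a b va vb; rewrite !scale1r. Qed.
Lemma flag_form0l a : m 0 a = 0.
Proof.
have /eqP := flag_formDl (dot0l a) (dot0l a); rewrite addr0 -subr_eq0 opprD addrA subrr sub0r.
by rewrite oppr_eq0 => /eqP.
Qed.
Lemma flag_form0r v : m v 0 = 0.
Proof.
have /eqP := flag_formDr (dot0r v) (dot0r v); rewrite addr0 -subr_eq0 opprD addrA subrr sub0r.
by rewrite oppr_eq0 => /eqP.
Qed.
Lemma flag_formZl k v a : dot v a = 0 -> m (k *: v) a = k *: m v a.
Proof. by move=> va; have := mP.1 k v 0 a va (dot0l a); rewrite flag_form0l !addr0. Qed.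
Lemma flag_formZr k v a : dot v a = 0 -> m v (k *: a) = k *: m v a.
Proof. by move=> va; have := mP.2 k v a 0 va (dot0r v); rewrite flag_form0r !addr0. Qed.

End FlagFormTheory.

Section FormEmbedding.
Variables (n : nat) (K : fieldType) (V : lmodType K).
Variable m : 'rV[K]_n.+1 -> 'cV[K]_n.+1 -> V.
Hypothesis mP : flag_form m.
Implicit Types (v : 'rV[K]_n.+1) (a : 'cV[K]_n.+1) (x y : flag n K).

(** Pairing [m] with the natural vectors makes injectivity and the covering of
    the natural embedding automatic. *)
Definition graph_vec v a : (adjoint n K * V)%type := (to_adjoint (a *m v), m v a).
Definition graph_set : set (adjoint n K * V)%type :=
  [set t | exists v a, dot v a = 0 /\ t = graph_vec v a].
Local Notation W := (span_mod graph_set).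

Definition form_vec v a : W := insubd 0 (graph_vec v a).

Lemma val_form_vec v a : dot v a = 0 -> span_val (form_vec v a) = graph_vec v a.
Proof. by move=> va; rewrite insubdK //; apply: mem_span; exists v, a. Qed.

Lemma form_vec1 v a : dot v a = 0 -> adj_val (span_val (form_vec v a)).1 = a *m v.
Proof. by move=> va; rewrite val_form_vec //= val_to_adjoint // tr_outer. Qed.

Lemma form_vec2 v a : dot v a = 0 -> (span_val (form_vec v a)).2 = m v a.
Proof. by move=> va; rewrite val_form_vec. Qed.

Lemma form_vec_form : flag_form form_vec.
Proof.
split=> [k u v a ua va|k v a b va vb]; apply: val_inj.
  have ha : dot (k *: u + v) a = 0 by rewrite dotDl dotZl ua va mulr0 addr0.
  change (span_val (form_vec (k *: u + v) a) =
    k *: span_val (form_vec u a) + span_val (form_vec v a)).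
  rewrite !val_form_vec // /graph_vec mP.1 //; congr pair.
  apply: adj_inj; rewrite adj_valD adj_valZ !val_to_adjoint ?tr_outer //.
  by rewrite mulmxDr scalemxAr.
have ha : dot v (k *: a + b) = 0 by rewrite dotDr dotZr va vb mulr0 addr0.
change (span_val (form_vec v (k *: a + b)) =
  k *: span_val (form_vec v a) + span_val (form_vec v b)).
rewrite !val_form_vec // /graph_vec mP.2 //; congr pair.
apply: adj_inj; rewrite adj_valD adj_valZ !val_to_adjoint ?tr_outer //.
by rewrite mulmxDl scalemxAl.
Qed.
Let fvP := form_vec_form.

Definition form_embedding (x : flag_geometry n K) : set W :=
  [set t | exists v a (k : K), represents x v a /\ t = k *: form_vec v a].

Lemma form_embeddingE x v a t : represents x v a ->
  form_embedding x t <-> exists k : K, t = k *: form_vec v a.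
Proof.
move=> R; split=> [[v' [a' [k [R' ->]]]]|[k ->]]; last by exists v, a, k.
have [l [l' [_ _ -> ->]]] := rep_proportional R R'; have [_ _ va] := rep_spec R.
exists (k * (l * l')).
by rewrite flag_formZl ?dotZr ?va ?mulr0 // flag_formZr // !scalerA mulrA.
Qed.

Lemma form_vec_neq0 v a : v != 0 -> a != 0 -> dot v a = 0 -> form_vec v a != 0.
Proof.
move=> v0 a0 va; apply: contraNneq (outer_neq0 v0 a0) => E.
by rewrite -(form_vec1 va) E.
Qed.

Definition fst_mx (t : W) := adj_val (span_val t).1.

Lemma fst_mxD s t : fst_mx (s + t) = fst_mx s + fst_mx t.
Proof. by []. Qed.

Lemma fst_mxZ k t : fst_mx (k *: t) = k *: fst_mx t.
Proof. by []. Qed.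

Lemma form_vec_inj (c d : K) v v' a a' : dot v a = 0 -> dot v' a' = 0 ->
  c *: form_vec v a + d *: form_vec v' a' = 0 ->
  c *: (a *m v) + d *: (a' *m v') = 0.
Proof.
move=> va va' /(congr1 fst_mx); rewrite fst_mxD !fst_mxZ /fst_mx.
by rewrite (form_vec1 va) (form_vec1 va').
Qed.

Lemma independent_form_row v v' a : independent2 v v' -> a != 0 ->
  dot v a = 0 -> dot v' a = 0 -> independent2 (form_vec v a) (form_vec v' a).
Proof.
move=> ind a0 va va' c d /(form_vec_inj va va'); rewrite !scalemxAr -mulmxDr => E.
apply: ind; apply/eqP; apply: contraTT isT => h.
by move/eqP: (outer_neq0 h a0); rewrite E.
Qed.

Lemma independent_form_col v a a' : independent2 a a' -> v != 0 ->
  dot v a = 0 -> dot v a' = 0 -> independent2 (form_vec v a) (form_vec v a').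
Proof.
move=> ind v0 va va' c d /(form_vec_inj va va'); rewrite !scalemxAl -mulmxDl => E.
apply: ind; apply/eqP; apply: contraTT isT => h.
by move/eqP: (outer_neq0 v0 h); rewrite E.
Qed.

Lemma form_embedding_pt x v a : represents x v a ->
  form_embedding x = [set t | exists c : K, t = c *: form_vec v a].
Proof. by move=> R; apply/seteqP; split=> t /(form_embeddingE _ R). Qed.

Lemma form_pg_point x : pg_point (form_embedding x).
Proof.
have [v [a R]] := rep_exists x; have [v0 a0 va] := rep_spec R.
by exists (form_vec v a); [apply: form_vec_neq0|apply: form_embedding_pt].
Qed.

(** Common to the two types of lines, [p] and [q] being the vectors of two
    points. *)
Lemma form_line (l : set (flag n K)) (p q : W) :
    independent2 p q ->
    (forall x, l x -> exists c d,
       form_embedding x = [set t | exists k : K, t = k *: (c *: p + d *: q)]) ->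
    (forall c d : K, c *: p + d *: q != 0 -> exists2 x, l x &
       form_embedding x = [set t | exists k : K, t = k *: (c *: p + d *: q)]) ->
  pg_line (form_embedding @` l).
Proof.
move=> ind sub sup; exists p, q; split=> //; apply/seteqP; split=> [_ [x lx <-]|P [[t t0 ->] Psub]].
  split; first exact: form_pg_point.
  have [c [d ->]] := sub x lx => _ [k ->].
  by exists (k * c), (k * d); rewrite scalerDr !scalerA.
have [c [d E]] : exists c d : K, t = c *: p + d *: q.
  by apply: Psub; exists 1; rewrite scale1r.
have [|x lx xE] := sup c d; first by rewrite -E.
by exists x => //; rewrite xE -E.
Qed.

Lemma form_is_embedding : is_embedding form_embedding.
Proof.
split; first exact: form_pg_point.
- move=> x y E; have [v [a R]] := rep_exists x; have [v' [a' R']] := rep_exists y.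
  have [_ _ va] := rep_spec R; have [v0' a0' va'] := rep_spec R'.
  have : form_embedding x (form_vec v' a').
    by rewrite E; apply/(form_embeddingE _ R'); exists 1; rewrite scale1r.
  case/(form_embeddingE _ R) => k Ek.
  have Ev : a' *m v' = k *: (a *m v).
    by rewrite -(form_vec1 va) -(form_vec1 va') Ek.
  apply: (outer_rep R R' _ Ev); apply/eqP => k0.
  by move: (outer_neq0 v0' a0'); rewrite Ev k0 scale0r eqxx.
- move=> l /flag_line_cases[[v [v' [a [ind a0 [va va'] lE]]]]|[v [a [a' [ind v0 [va va'] lE]]]]].
    have Fcd c d : form_vec (c *: v + d *: v') a = c *: form_vec v a + d *: form_vec v' a.
      by rewrite fvP.1 ?dotZl ?va' ?mulr0 // flag_formZl.
    apply: (@form_line l (form_vec v a) (form_vec v' a)) => //.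
    + exact: independent_form_row.
    + move=> x /lE[c [d R]]; exists c, d.
      by rewrite (form_embedding_pt R) Fcd.
    move=> c d; rewrite -Fcd => h.
    have v0 : c *: v + d *: v' != 0 by apply: contraNneq h => ->; rewrite flag_form0l.
    have [|x R] := rep_ex v0 a0; first by rewrite dotDl !dotZl va va' !mulr0 addr0.
    by exists x; [apply/lE; exists c, d|apply: form_embedding_pt].
  have Fcd c d : form_vec v (c *: a + d *: a') = c *: form_vec v a + d *: form_vec v a'.
    by rewrite fvP.2 ?dotZr ?va' ?mulr0 // flag_formZr.
  apply: (@form_line l (form_vec v a) (form_vec v a')) => //.
  + exact: independent_form_col.
  + move=> x /lE[c [d R]]; exists c, d.
    by rewrite (form_embedding_pt R) Fcd.
  move=> c d; rewrite -Fcd => h.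
  have a0 : c *: a + d *: a' != 0 by apply: contraNneq h => ->; rewrite flag_form0r.
  have [|x R] := rep_ex v0 a0; first by rewrite dotDr !dotZr va va' !mulr0 addr0.
  by exists x; [apply/lE; exists c, d|apply: form_embedding_pt].
move=> U UP h; apply: span_generated => // t tX.
have [v [a [va E]]] := tX.
have -> : SpanMod (mem_span tX) = form_vec v a.
  by apply: val_inj; rewrite /= val_form_vec.
have [v0|v0] := eqVneq v 0; first by rewrite v0 flag_form0l //; case: UP.
have [a0|a0] := eqVneq a 0; first by rewrite a0 flag_form0r //; case: UP.
have [x R] := rep_ex v0 a0 va; apply: (h x).
by apply/(form_embeddingE _ R); exists 1; rewrite scale1r.
Qed.

Lemma form_covers : covers form_embedding (@nat_embedding n K).
Proof.
exists idfun, (fun t : W => (span_val t).1); split.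
  by split; [exists idfun|].
move=> x; have [v [a R]] := rep_exists x; have [_ _ va] := rep_spec R.
apply/seteqP; split=> [_ [t /(form_embeddingE _ R)[k ->] <-]|s /(nat_embeddingE _ R)[k sE]].
  by apply/(nat_embeddingE _ R); exists k; rewrite -(form_vec1 va).
exists (k *: form_vec v a); first by apply/(form_embeddingE _ R); exists k.
by apply: adj_inj; rewrite sE -(form_vec1 va).
Qed.

End FormEmbedding.

(** * Universality among flag forms *)
Lemma scaler_eq_coef (K : fieldType) (V : lmodType K) (x : V) (k l : K) :
  x != 0 -> k *: x = l *: x -> k = l.
Proof.
move=> x0 /eqP; rewrite -subr_eq0 -scalerBl scaler_eq0 (negbTE x0) orbF subr_eq0.
by move/eqP.
Qed.

Section Universal.
Variables (n : nat) (K : fieldType) (Ahat : lmodType K).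
Variables (ehat : flag_geometry n K -> set Ahat) (phi : {linear Ahat -> adjoint n K}).
Hypotheses (n2 : (2 <= n)%N).
Hypothesis ehatU : relatively_universal_cover ehat (@nat_embedding n K).
Hypothesis phiP : projects phi ehat (@nat_embedding n K).
Implicit Types (x y z : flag n K) (u v w : 'rV[K]_n.+1) (a b : 'cV[K]_n.+1).

Let N3 : (2 < n.+1)%N. Proof. by []. Qed.
Let ehatP : is_embedding ehat. Proof. by case: ehatU. Qed.
Local Notation fv := (flag_vec ehat phi).
Let fvF := flag_vec_form ehatP phiP.

(** The map [psi] provided by universality sends [flag_vec v a] to a multiple
    [k] of the graph vector. Additivity along a line shows that [k] does not
    change along lines, and that the field automorphism [sigma] is trivial, as
    a flag and its rescalings have collinear companions in common. Any two
    flags being joined by lines, [k] is constant; the second component of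
    [psi], divided by [k], is the required map. *)
Lemma universal_form (V : lmodType K) (m : 'rV[K]_n.+1 -> 'cV[K]_n.+1 -> V) :
  flag_form m ->
  exists f : {linear Ahat -> V}, forall v a, dot v a = 0 -> f (fv v a) = m v a.
Proof.
move=> mP; pose s := form_vec m; have sP := form_vec_form mP.
have [_ _ U] := ehatU.
have [sigma [psi [[sbij psiL] psiP]]] := U _ _ _ (form_is_embedding mP) (form_covers mP).
have psi0 : psi 0 = 0.
  have /eqP := psiL 1 0 0; rewrite scaler0 addr0 rmorph1 scale1r -subr_eq0 opprD addrA subrr sub0r.
  by rewrite oppr_eq0 => /eqP.
have psiZ c (t : Ahat) : psi (c *: t) = sigma c *: psi t.
  by have := psiL c t 0; rewrite psi0 !addr0.
have psiD (t t' : Ahat) : psi (t + t') = psi t + psi t'.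
  by have := psiL 1 t t'; rewrite rmorph1 !scale1r.
pose R v a k := psi (fv v a) = k *: s v a.
have Rex v a : v != 0 -> a != 0 -> dot v a = 0 -> exists2 k, R v a k & k != 0.
  move=> v0 a0 va; have [x Rx] := rep_ex v0 a0 va.
  have [xw _] := flag_vecP phiP Rx.
  have : form_embedding (m := m) x (psi (fv v a)) by rewrite -(psiP x); exists (fv v a).
  case/(form_embeddingE mP _ Rx) => k Ek; exists k => //; apply/eqP => k0.
  have : form_embedding (m := m) x (s v a).
    by apply/(form_embeddingE mP _ Rx); exists 1; rewrite scale1r.
  rewrite -(psiP x) => -[u /(ehat_vec ehatP phiP _ Rx)[l ->]].
  rewrite psiZ Ek k0 scale0r scaler0 => /esym E.
  by move: (form_vec_neq0 m v0 a0 va); rewrite -/s -E eqxx.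
have Rrow v v' a k k' : independent2 v v' -> a != 0 -> dot v a = 0 -> dot v' a = 0 ->
    R v a k -> R v' a k' -> k = k'.
  move=> ind a0 va va' Rv Rv'.
  have vD0 : v + v' != 0.
    by have := independent2_neq (-1) ind; rewrite scaleN1r -addr_eq0.
  have [|k2 E _] := Rex (v + v') a vD0 a0; first by rewrite dotDl va va' addr0.
  have ind' : independent2 (s v a) (s v' a) by apply: independent_form_row.
  have [|h1 h2] := ind' (k - k2) (k' - k2).
    rewrite !scalerBl addrACA -opprD -scalerDr -/s -(flag_formDl sP) // -E -Rv -Rv' -psiD.
    by rewrite -(flag_formDl fvF) // subrr.
  by rewrite (subr0_eq h1) (subr0_eq h2).
have Rcol v a a' k k' : independent2 a a' -> v != 0 -> dot v a = 0 -> dot v a' = 0 ->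
    R v a k -> R v a' k' -> k = k'.
  move=> ind v0 va va' Rv Rv'.
  have aD0 : a + a' != 0.
    by have := independent2_neq (-1) ind; rewrite scaleN1r -addr_eq0.
  have [|k2 E _] := Rex v (a + a') v0 aD0; first by rewrite dotDr va va' addr0.
  have ind' : independent2 (s v a) (s v a') by apply: independent_form_col.
  have [|h1 h2] := ind' (k - k2) (k' - k2).
    rewrite !scalerBl addrACA -opprD -scalerDr -/s -(flag_formDr sP) // -E -Rv -Rv' -psiD.
    by rewrite -(flag_formDr fvF) // subrr.
  by rewrite (subr0_eq h1) (subr0_eq h2).
have other_row v a : v != 0 ->
    exists2 v', dot v' a = 0 & forall k, k != 0 -> independent2 (k *: v) v'.
  move=> v0; have [v' v'a v'v] := kernel_avoids1 a v N3; exists v' => // k k0.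
  apply: independent2C; apply: neq_independent2; first by rewrite scaler_eq0 negb_or k0.
  by move=> l; rewrite scalerA.
have [v0 [a0 [v0n0 a0n0 va0]]] : exists (v0 : 'rV[K]_n.+1) (a0 : 'cV[K]_n.+1),
    [/\ v0 != 0, a0 != 0 & dot v0 a0 = 0].
  have v00 : (delta_mx 0 0 : 'rV[K]_n.+1) != 0.
    by apply/eqP => /rowP/(_ 0)/eqP; rewrite !mxE !eqxx oner_eq0.
  have [b [b0 vb _]] := kernel_meet_col (delta_mx 0 0 : 'rV[K]_n.+1) 0 N3.
  by exists (delta_mx 0 0), b.
have sigma1 c : sigma c = c.
  have [->|c0] := eqVneq c 0; first by rewrite rmorph0.
  have [v' v'a ind] := other_row v0 a0 v0n0.
  have v'0 : v' != 0.
    by have := independent2_neq 0 (independent2C (ind 1 (oner_neq0 K))); rewrite scale0r.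
  have [k Rk k0] := Rex _ _ v0n0 a0n0 va0; have [k' Rk' _] := Rex _ _ v'0 a0n0 v'a.
  have cva : dot (c *: v0) a0 = 0 by rewrite dotZl va0 mulr0.
  have cv0 : c *: v0 != 0 by rewrite scaler_eq0 negb_or c0.
  have [k2 Rk2 _] := Rex _ _ cv0 a0n0 cva.
  have e1 : k = k'.
    by apply: (Rrow v0 v' a0) => //; have := ind 1 (oner_neq0 K); rewrite scale1r.
  have e2 : k2 = k' by apply: (Rrow (c *: v0) v' a0) => //; apply: ind.
  have H : (sigma c * k) *: s v0 a0 = (c * k) *: s v0 a0.
    rewrite -scalerA -[k *: _]Rk -psiZ -(flag_formZl fvF) // [LHS]Rk2 e2 -e1.
    by rewrite [s _ _](flag_formZl sP) // scalerA mulrC.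
  exact: mulIf k0 _ _ (scaler_eq_coef (form_vec_neq0 m v0n0 a0n0 va0) H).
(* With [sigma] trivial, proportional representatives have the same factor. *)
have Rrow' v v' a k k' : v != 0 -> v' != 0 -> a != 0 -> dot v a = 0 -> dot v' a = 0 ->
    R v a k -> R v' a k' -> k = k'.
  move=> v_0 v'0 a_0 va va' Rv Rv'.
  have [[l E]|h] := proportional_row v v'; last first.
    by apply: (Rrow v v' a) => //; apply: neq_independent2.
  have l0 : l != 0 by apply: contraNneq v_0 => l0; rewrite E l0 scale0r.
  have H : (k * l) *: s v' a = (k' * l) *: s v' a.
    rewrite -scalerA -[l *: _](flag_formZl sP) // -E -[LHS]Rv E (flag_formZl fvF) // psiZ sigma1.
    by rewrite [psi _]Rv' scalerA mulrC.
  exact: mulIf l0 _ _ (scaler_eq_coef (form_vec_neq0 m v'0 a_0 va') H).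
have Rcol' v a a' k k' : v != 0 -> a != 0 -> a' != 0 -> dot v a = 0 -> dot v a' = 0 ->
    R v a k -> R v a' k' -> k = k'.
  move=> v_0 a_0 a'0 va va' Rv Rv'.
  have [[l E]|h] := proportional_col a a'; last first.
    by apply: (Rcol v a a') => //; apply: neq_independent2.
  have l0 : l != 0 by apply: contraNneq a_0 => l0; rewrite E l0 scale0r.
  have H : (k * l) *: s v a' = (k' * l) *: s v a'.
    rewrite -scalerA -[l *: _](flag_formZr sP) // -E -[LHS]Rv E (flag_formZr fvF) // psiZ sigma1.
    by rewrite [psi _]Rv' scalerA mulrC.
  exact: mulIf l0 _ _ (scaler_eq_coef (form_vec_neq0 m v_0 a'0 va') H).
have [k0 Rk0 k00] := Rex _ _ v0n0 a0n0 va0.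
have Rall v a : dot v a = 0 -> R v a k0.
  move=> va; have [->|v_0] := eqVneq v 0.
    by rewrite /R flag_vec0l psi0 /s (flag_form0l sP) scaler0.
  have [->|a_0] := eqVneq a 0.
    by rewrite /R flag_vec0r psi0 /s (flag_form0r sP) scaler0.
  have [k Rk _] := Rex _ _ v_0 a_0 va.
  have [w [w0 wa wa0]] := kernel_meet a a0 N3.
  have [k1 Rk1 _] := Rex _ _ w0 a_0 wa; have [k2 Rk2 _] := Rex _ _ w0 a0n0 wa0.
  have <- : k = k0; last by [].
  rewrite (Rrow' v w a k k1) // (Rcol' w a a0 k1 k2) //.
  by apply: (Rrow' w v0 a0).
have flin : linear (fun t : Ahat => k0^-1 *: (span_val (psi t)).2 : V).
  move=> c u u'; rewrite psiL sigma1.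
  change (k0^-1 *: (c *: (span_val (psi u)).2 + (span_val (psi u')).2) =
    c *: (k0^-1 *: (span_val (psi u)).2) + k0^-1 *: (span_val (psi u')).2).
  by rewrite scalerDr !scalerA mulrC.
have [f fE] := linear_ex flin; exists f => v a va.
rewrite fE (Rall _ _ va).
change (k0^-1 *: (k0 *: (span_val (s v a)).2) = m v a).
by rewrite scalerA mulVf // scale1r form_vec2.
Qed.

End Universal.

(** * The lifted action *)
Section InvariantForm.
Variables (n : nat) (K : fieldType) (V : lmodType K).
Variable m : 'rV[K]_n.+1 -> 'cV[K]_n.+1 -> V.
Hypotheses (n2 : (2 <= n)%N) (mP : flag_form m).

(** Take [u] killed by [a] and independent of [v]: a transvection fixing [a]
    moves [u] to [u + v], so [m u a = m u a + m v a]. *)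
Lemma invariant_form_eq0 :
    (forall (g : SL n K) v a, dot v a = 0 -> m (v *m g) ((g^-1)%g *m a) = m v a) ->
  forall v a, dot v a = 0 -> m v a = 0.
Proof.
move=> inv v a va; have [u ua uv] := @kernel_avoids1 K n.+1 a v n2.
have [b vb ub] := separate1 uv.
have := inv (transvection b v) u a ua.
rewrite row_transvection // ub scale1r transvectionV_col // va scale0r subr0.
rewrite (flag_formDl mP) // => /eqP.
by rewrite -subr_eq0 addrAC subrr add0r => /eqP.
Qed.

End InvariantForm.

Section Action.
Variables (n : nat) (K : fieldType) (Ahat : lmodType K).
Variables (ehat : flag_geometry n K -> set Ahat) (phi : {linear Ahat -> adjoint n K}).
Hypotheses (n2 : (2 <= n)%N).
Hypothesis ehatU : relatively_universal_cover ehat (@nat_embedding n K).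
Hypothesis phiP : projects phi ehat (@nat_embedding n K).
Implicit Types (x y z : flag n K) (u v w : 'rV[K]_n.+1) (a b : 'cV[K]_n.+1).
Implicit Types (g h : SL n K) (s t : Ahat).

Let N3 : (2 < n.+1)%N. Proof. by []. Qed.
Let ehatP : is_embedding ehat. Proof. by case: ehatU. Qed.
Local Notation fv := (flag_vec ehat phi).
Let fvF : flag_form fv. Proof. exact: flag_vec_form ehatP phiP. Qed.

Lemma linear_ext (V : lmodType K) (f f' : Ahat -> V) : linear f -> linear f' ->
  (forall v a, dot v a = 0 -> f (fv v a) = f' (fv v a)) -> f =1 f'.
Proof.
move=> lf lf' h t; apply/eqP.
apply: (flag_vec_span ehatP phiP (U := fun t => f t == f' t)) => [|v a va].
  split=> [|k p q]; rewrite !unfold_in.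
    have z (F : Ahat -> V) : linear F -> F 0 = 0.
      move=> lF; have := lF (-1) 0 0; rewrite scaler0 addr0 => ->.
      by rewrite scaleN1r addNr.
    by rewrite !z.
  by move=> /eqP hp /eqP hq; rewrite lf lf' hp hq.
by rewrite unfold_in h.
Qed.

Lemma dot_act g v a : dot (v *m g) ((g^-1)%g *m a) = dot v a.
Proof. by rewrite dot_mulmx mulmxA SL_mulV_val mul1mx. Qed.

Lemma rep_act x g v a : represents x v a ->
  represents (flag_act x g) (v *m g) ((g^-1)%g *m a).
Proof.
case=> px hx; split=> [|w]; first by rewrite /= /sub_act px limg_line lfunE.
rewrite mulmxA -hx /=; apply/memv_imgP/idP => [[u uH ->]|wH].
  by rewrite lfunE /= -mulmxA SL_mulV_val mulmx1.
by exists (w *m (g^-1)%g) => //; rewrite lfunE /= -mulmxA SL_mulVg_val mulmx1.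
Qed.

Lemma adj_actE (r : adjoint n K) g :
  adj_val (adj_raction n K r g) = (g^-1)%g *m adj_val r *m g.
Proof. by []. Qed.

Lemma act_flag_form g : flag_form (fun v a => fv (v *m g) ((g^-1)%g *m a)).
Proof.
split=> [k u v a ua va|k v a b va vb].
  by rewrite mulmxDl -scalemxAl fvF.1 ?dot_act.
by rewrite mulmxDr -scalemxAr fvF.2 ?dot_act.
Qed.

Lemma lift_exists : exists act : raction (SL n K) Ahat, lifts_action ehat phi act.
Proof.
have [F FP] := choice (fun g => universal_form n2 ehatU phiP (act_flag_form g)).
have F1 t : F 1%g t = t.
  apply: (linear_ext (f := F 1%g) (f' := id)) => // [|v a va]; first exact: linearP.
  by rewrite FP // invg1 SL_val1 mulmx1 mul1mx.
have FM t g h : F (g * h)%g t = F h (F g t).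
  apply: (linear_ext (f := F (g * h)%g) (f' := F h \o F g)) => [||v a va].
  - exact: linearP.
  - by move=> k p q /=; rewrite !linearP.
  by rewrite /= !FP ?dot_act // invgM !SL_valM !mulmxA.
have lF g : linear (fun t => F g t) by exact: linearP.
have phiF t g : phi (F g t) = adj_raction n K (phi t) g.
  apply: (linear_ext (f := phi \o F g) (f' := fun t => adj_raction n K (phi t) g)) => [||v a va].
  - by move=> k p q /=; rewrite !linearP.
  - by move=> k p q; rewrite linearP ract_linear.
  apply: adj_inj; rewrite adj_actE /= FP // !(phi_flag_vec phiP) ?dot_act //.
  by rewrite !mulmxA.
exists (RAction (ract := fun t g => F g t) lF F1 FM); split=> /=; last exact: phiF.
  move=> x g; have [v [a R]] := rep_exists x; have [_ _ va] := rep_spec R.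
  have R' := rep_act g R; apply/seteqP; split=> [_ [t /(ehat_vec ehatP phiP _ R)[k ->] <-]|t].
    by rewrite linearZ /= FP //; apply/(ehat_vec ehatP phiP _ R'); exists k.
  case/(ehat_vec ehatP phiP _ R') => k ->; exists (k *: fv v a).
    by apply/(ehat_vec ehatP phiP _ R); exists k.
  by rewrite linearZ /= FP.
move=> t g; rewrite !unfold_in phiF => /eqP ->.
have := ract_linear (adj_raction n K) g (-1) 0 0.
by rewrite scaler0 addr0 scaleN1r addNr => ->.
Qed.

(** These matrices are sums of rank one matrices of trace zero, and every
    traceless matrix is the combination of them with its own entries as
    coefficients. *)
Lemma matrix_unit_lift (i j : 'I_n.+1) : exists t,
  adj_val (phi t) = delta_mx i j - (i == j)%:R *: delta_mx 0 0.
Proof.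
pose e (k : 'I_n.+1) : 'rV[K]_n.+1 := delta_mx 0 k.
pose f (k : 'I_n.+1) : 'cV[K]_n.+1 := delta_mx k 0.
have ef k l : dot (e k) (f l) = (k == l)%:R by rewrite /dot -rowE !mxE eqxx andbT.
have fe k l : f k *m e l = delta_mx k l by rewrite mul_delta_mx.
have phiE u b : dot u b = 0 -> adj_val (phi (fv u b)) = b *m u :=
  @phi_flag_vec _ _ _ _ _ phiP u b.
have [<-|ij] := eqVneq i j; last first.
  by exists (fv (e j) (f i)); rewrite phiE ?ef 1?eq_sym ?(negbTE ij) // scale0r subr0 fe.
have [->|i0] := eqVneq i 0; first by exists 0; rewrite linear0 scale1r subrr.
exists (fv (e i - e 0) (f i + f 0) + fv (e 0) (f i) + (-1) *: fv (e i) (f 0)).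
have i0' : 0 != i by rewrite eq_sym.
have h1 : dot (e i - e 0) (f i + f 0) = 0.
  by rewrite dotDl !dotDr !dotNl !ef !eqxx (negbTE i0) (negbTE i0') addr0 oppr0 add0r addrN.
rewrite 2!linearD !adj_valD phi_valZ scaleN1r.
rewrite !phiE ?ef ?(negbTE i0) ?(negbTE i0') // mulmxDl !mulmxBr !fe scale1r.
by rewrite [X in X - _]addrAC subrK addrA addrAC addrK.
Qed.

Lemma linear_section : exists s : {linear adjoint n K -> Ahat}, cancel s phi.
Proof.
have [r rP] := choice (fun p : 'I_n.+1 * 'I_n.+1 => matrix_unit_lift p.1 p.2).
pose f (q : adjoint n K) : Ahat := \sum_i \sum_j adj_val q i j *: r (i, j).
have lf : linear f.
  move=> k p q; rewrite /f scaler_sumr -big_split; apply: eq_bigr => i _ /=.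
  rewrite scaler_sumr -big_split; apply: eq_bigr => j _ /=.
  by rewrite mxE mxE scalerDl scalerA.
have [s sE] := linear_ex lf; exists s => q; rewrite sE; apply: adj_inj.
pose psi t := adj_val (phi t).
have psi_sum (I : Type) (l : seq I) (F : I -> Ahat) :
    psi (\sum_(i <- l) F i) = \sum_(i <- l) psi (F i).
  by apply: big_morph => [x y|]; rewrite /psi ?linearD ?linear0.
rewrite -/(psi _) psi_sum [RHS]matrix_sum_delta.
have row_sum i : psi (\sum_j adj_val q i j *: r (i, j)) =
    (\sum_j adj_val q i j *: delta_mx i j) - adj_val q i i *: delta_mx 0 0.
  rewrite psi_sum; under eq_bigr => j _ do rewrite /psi phi_valZ rP /= scalerBr scalerA.
  rewrite sumrB; congr (_ - _); rewrite (bigD1 i) //= eqxx mulr1 big1 ?addr0 // => j ji.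
  by rewrite eq_sym (negbTE ji) mulr0 scale0r.
under eq_bigr => i _ do rewrite row_sum.
rewrite sumrB -scaler_suml -[\sum_i _ i i]/(\tr (adj_val q)) tr_adj scale0r subr0.
by [].
Qed.

Section Lift.
Variable act : raction (SL n K) Ahat.
Hypothesis actP : lifts_action ehat phi act.

Lemma ract0 g : act 0 g = 0.
Proof.
have := ract_linear act g (-1) 0 0.
by rewrite scaler0 addr0 scaleN1r addNr => ->.
Qed.
Lemma ractD s t g : act (s + t) g = act s g + act t g.
Proof. by have := ract_linear act g 1 s t; rewrite !scale1r. Qed.
Lemma ractZ k t g : act (k *: t) g = k *: act t g.
Proof. by have := ract_linear act g k t 0; rewrite ract0 !addr0. Qed.
Lemma ractB s t g : act (s - t) g = act s g - act t g.
Proof. by rewrite ractD -scaleN1r ractZ scaleN1r. Qed.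

Lemma act_flag_vec g v a : dot v a = 0 ->
  act (fv v a) g = fv (v *m g) ((g^-1)%g *m a).
Proof.
move=> va; have [->|v0] := eqVneq v 0; first by rewrite mul0mx !flag_vec0l ract0.
have [->|a0] := eqVneq a 0; first by rewrite mulmx0 !flag_vec0r ract0.
have [x R] := rep_ex v0 a0 va; have [xw hw] := flag_vecP phiP R.
case: actP => actx _ acth; apply: (flag_vec_eq ehatP phiP (rep_act g R)).
  by rewrite -actx; exists (fv v a).
by rewrite acth adj_actE hw !mulmxA.
Qed.

Section Transvection.
Variables (v : 'rV[K]_n.+1) (a : 'cV[K]_n.+1).
Hypotheses (v0 : v != 0) (a0 : a != 0) (va : dot v a = 0).
Local Notation T := (transvection a v).

(** The vectors of the flags equal or collinear to [v, a] span this set; it is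
    closed under sums because the flag vectors with a fixed component [a] or
    [v] add up. *)
Definition root_nbhd t := exists u b, [/\ dot u a = 0, dot v b = 0 & t = fv u a + fv v b].

Lemma root_nbhd_lin k s t : root_nbhd s -> root_nbhd t -> root_nbhd (k *: s + t).
Proof.
move=> [u [b [ua vb ->]]] [u' [b' [ua' vb' ->]]].
exists (k *: u + u'), (k *: b + b'); split.
- by rewrite dotDl dotZl ua ua' mulr0 addr0.
- by rewrite dotDr dotZr vb vb' mulr0 addr0.
by rewrite fvF.1 // fvF.2 // scalerDr addrACA.
Qed.

(** The matrices [a *m u] and [b *m v] have different row spaces unless [u] is
    a multiple of [v], and then the sum is the single flag vector of [v]. *)
Lemma root_nbhd_inj t : root_nbhd t -> phi t = 0 -> t = 0.
Proof.
move=> [u [b [ua vb ->]]] E.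
have {}E : a *m u + b *m v = 0.
  have <- : adj_val (phi (fv u a + fv v b)) = a *m u + b *m v.
    by rewrite linearD adj_valD !(phi_flag_vec phiP).
  by rewrite E.
have [[k uk]|h] := proportional_row u v.
  rewrite uk (flag_formZl fvF) // -(flag_formZr fvF) // -(flag_formDr fvF) ?dotZr ?va ?mulr0 //.
  move: E; rewrite uk -scalemxAr scalemxAl -mulmxDl => E.
  have [->|kab] := eqVneq (k *: a + b) 0; first by rewrite flag_vec0r.
  by move/eqP: (outer_neq0 v0 kab); rewrite E.
have [c vc uc] := separate1 h; case/eqP: a0.
have := congr1 (mulmx^~ c) E; rewrite mulmxDl !outer_col mul0mx uc vc.
by rewrite scale1r scale0r addr0.
Qed.

(** The vectors that [t - 1] sends into [root_nbhd] form a submodule, which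
    contains all flag vectors not opposite to [v, a] ([near_flag_vec]). *)
Definition near_root t := root_nbhd (act t T - t).

Lemma near_lin k s t : near_root s -> near_root t -> near_root (k *: s + t).
Proof.
move=> hs ht; rewrite /near_root ractD ractZ.
have -> : k *: act s T + act t T - (k *: s + t) = k *: (act s T - s) + (act t T - t).
  by rewrite scalerBr opprD addrACA.
exact: root_nbhd_lin.
Qed.

Lemma near_flag_vec u b : dot u b = 0 -> dot u a = 0 \/ dot v b = 0 ->
  near_root (fv u b).
Proof.
move=> ub h; rewrite /near_root act_flag_vec // row_transvection // transvectionV_col //.
case: h => h; rewrite h scale0r ?addr0 ?subr0.
  exists (- dot v b *: u), 0; rewrite dotZl h mulr0 dot0r flag_vec0r addr0; split=> //.
  rewrite -scaleNr (flag_formDr fvF) ?dotZr ?h ?mulr0 // addrAC subrr add0r.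
  by rewrite (flag_formZr fvF) // (flag_formZl fvF).
exists 0, (dot u a *: b); rewrite dotZr h mulr0 dot0l flag_vec0l add0r; split=> //.
rewrite (flag_formDl fvF) ?dotZl ?h ?mulr0 // addrAC subrr add0r.
by rewrite (flag_formZl fvF) // (flag_formZr fvF).
Qed.

Lemma near_trans s t r : near_root (s - t) -> near_root (t - r) -> near_root (s - r).
Proof.
move=> hs ht; have := near_lin 1 hs ht.
by rewrite scale1r addrA subrK.
Qed.

Lemma near0 : near_root 0.
Proof.
rewrite /near_root ract0 subr0; exists 0, 0.
by rewrite dot0l dot0r flag_vec0l flag_vec0r addr0.
Qed.

Lemma near_scale k t : near_root t -> near_root (k *: t).
Proof. by move=> ht; have := near_lin k ht near0; rewrite addr0. Qed.

Lemma near_row u u' b : dot u b = 0 -> dot u' b = 0 -> dot u' a = 1 ->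
  near_root (fv u b - dot u a *: fv u' b).
Proof.
move=> ub ub' ua'.
rewrite -scaleNr -(flag_formZl fvF) // -(flag_formDl fvF) ?dotZl ?ub' ?mulr0 //.
apply: near_flag_vec; first by rewrite dotDl dotZl ub ub' mulr0 addr0.
by left; rewrite dotDl dotZl ua' mulr1 addrN.
Qed.

Lemma near_col u b b' : dot u b = 0 -> dot u b' = 0 -> dot v b' = 1 ->
  near_root (fv u b - dot v b *: fv u b').
Proof.
move=> ub ub' vb'.
rewrite -scaleNr -(flag_formZr fvF) // -(flag_formDr fvF) ?dotZr ?ub' ?mulr0 //.
apply: near_flag_vec; first by rewrite dotDr dotZr ub ub' mulr0 addr0.
by right; rewrite dotDr dotZr vb' mulr1 addrN.
Qed.

(** Within a fixed hyperplane or a fixed point, two opposite flags with the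
    same normalization differ by a flag that is not opposite. Four such steps
    join [u, b] to [u0, b0], through a point [u1] of [b] and a hyperplane [b1]
    containing [u1] and [u0]. Such a [b1] can avoid [v] when [u1 - u0] is
    not a multiple of [v], which is arranged by moving [u1] inside
    the intersection of [b] and [a]. *)
Lemma near_opposite u0 b0 : dot u0 b0 = 0 -> dot u0 a = 1 -> dot v b0 = 1 ->
  forall u b, dot u b = 0 -> near_root (fv u b - (dot u a * dot v b) *: fv u0 b0).
Proof.
move=> ub0 ua0 vb0 u b ub.
have [ua|ua] := eqVneq (dot u a) 0.
  by rewrite ua mul0r scale0r subr0; apply: near_flag_vec => //; left.
have [vb|vb] := eqVneq (dot v b) 0.
  by rewrite vb mulr0 scale0r subr0; apply: near_flag_vec => //; right.
have [u1 [u1b u1a u1v]] : exists u1, [/\ dot u1 b = 0, dot u1 a = 1 &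
    forall k, u1 - u0 != k *: v].
  pose u1 := (dot u a)^-1 *: u.
  have u1b : dot u1 b = 0 by rewrite dotZl ub mulr0.
  have u1a : dot u1 a = 1 by rewrite dotZl mulVf.
  have [[k Ek]|h] := proportional_row (u1 - u0) v; last by exists u1.
  have [y [y0 yb ya]] := kernel_meet b a N3.
  exists (u1 + y); split; first by rewrite dotDl u1b yb addr0.
    by rewrite dotDl u1a ya addr0.
  move=> l; apply/eqP => El.
  have yv : y = (l - k) *: v by rewrite scalerBl -El -Ek opprB addrA subrK addrAC subrr add0r.
  move: yb; rewrite yv dotZl => /eqP; rewrite mulf_eq0 (negbTE vb) orbF => /eqP lk.
  by move: y0; rewrite yv lk scale0r eqxx.
have [|b1 /eqP] := @separate K n.+1 (1 + 1) (col_mx u1 u0) v.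
  apply/negP => /submxP[D]; rewrite -[D]hsubmxK mul_row_col.
  rewrite [lsubmx D]mx11_scalar [rsubmx D]mx11_scalar !mul_scalar_mx.
  set d := lsubmx D 0 0; set d' := rsubmx D 0 0 => Ev.
  have dd : d + d' = 0 by rewrite -va Ev dotDl !dotZl u1a ua0 !mulr1.
  move: Ev; have -> : d' = - d by apply/eqP; rewrite -addr_eq0 addrC dd.
  rewrite scaleNr -scalerBr => Ev.
  have d0 : d != 0 by apply: contraNneq v0 => d0; rewrite Ev d0 scale0r.
  by move: (u1v d^-1); rewrite Ev scalerA mulVf // scale1r eqxx.
rewrite mul_col_mx col_mx_eq0 !dot_eq0 => /andP[/eqP u1b1 /eqP u0b1] vb1.
have h1 := near_row ub u1b u1a.
have h2 := near_scale (dot u a) (near_col u1b u1b1 vb1).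
have h3 := near_scale (dot u a * dot v b) (near_row u1b1 u0b1 ua0).
have h4 := near_scale (dot u a * dot v b) (near_col u0b1 ub0 vb0).
move: h2 h3 h4; rewrite !scalerBr !scalerA u1a vb1 !mulr1 => h2 h3 h4.
exact: near_trans h1 (near_trans h2 (near_trans h3 h4)).
Qed.

(** The coefficient [chi] of the opposite direction depends on [phi s] only, so
    it vanishes on the kernel; there [act t T - t] lies in [root_nbhd] and in
    the kernel, hence is zero. *)
Lemma transvection_fixes_kernel t : phi t = 0 -> act t T = t.
Proof.
move=> t0.
have [u0 ua0] := dual_col a0.
have vu0 k : v != k *: u0.
  apply: contra_neq v0 => E; move: va; rewrite E dotZl ua0 mulr1 => ->.
  by rewrite scale0r.
have [b0 ub0 vb0] := separate1 vu0.
pose chi s : K := dot v (adj_val (phi s) *m a).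
have chiL k p q : chi (k *: p + q) = k * chi p + chi q.
  by rewrite /chi linearD adj_valD phi_valZ mulmxDl -scalemxAl dotDr dotZr.
pose U : {pred Ahat} := fun s => `[< near_root (s - chi s *: fv u0 b0) >].
have UP : submod_closed U.
  split=> [|k p q]; rewrite !unfold_in.
    by apply/asboolP; rewrite /chi linear0 mul0mx dot0r scale0r subr0; apply: near0.
  move=> /asboolP hp /asboolP hq; apply/asboolP.
  have -> : k *: p + q - chi (k *: p + q) *: fv u0 b0 =
      k *: (p - chi p *: fv u0 b0) + (q - chi q *: fv u0 b0).
    by rewrite chiL scalerDl -scalerA opprD scalerBr addrACA.
  exact: near_lin.
have H s : near_root (s - chi s *: fv u0 b0).
  apply/asboolP; apply: (flag_vec_span ehatP phiP UP) => u b ub; apply/asboolP.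
  by rewrite /chi (phi_flag_vec phiP) // outer_col dotZr; apply: near_opposite.
have := H t; rewrite /chi t0 mul0mx dot0r scale0r subr0 => ht.
apply/eqP; rewrite -subr_eq0; apply/eqP; apply: (root_nbhd_inj ht).
case: actP => _ _ acth; rewrite linearB acth t0.
have := ract_linear (adj_raction n K) T (-1) 0 0.
by rewrite scaler0 addr0 scaleN1r addNr => ->; rewrite subrr.
Qed.

End Transvection.

Lemma lift_central : central act (kerp phi).
Proof.
move=> t g; rewrite unfold_in => /eqP; move: g t.
apply: SL_transvection_ind => [g h hg hh t t0|a v va t t0]; first by rewrite ractM hg ?hh.
have [->|a0] := eqVneq a 0; first by rewrite transvection0 ract1.
have [->|v0] := eqVneq v 0; first by rewrite transvection0r ract1.
exact: transvection_fixes_kernel.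
Qed.

Lemma lift_extension : is_extension act (adj_raction n K) (kerp phi) phi.
Proof.
case: actP => _ actk acth; split=> //; first exact: kerp_submod_closed.
by move=> q; have [s sK] := linear_section; exists (s q).
Qed.

(** An equivariant section composed with [phi] agrees with the identity on flag
    vectors, since their difference is an invariant form; the kernel is then
    zero, contrary to the definition of a splitting. *)
Lemma lift_nonsplit : non_split act (kerp phi) phi.
Proof.
case=> [[w wk w0] [s [sinj sact sK]]].
case: actP => _ _ acth.
have sg q g : act (s q) g = s (adj_raction n K q g).
  have [q' E] := sact q g; rewrite E; congr (s _).
  by rewrite -[LHS]sK -E acth sK.
pose m v a := s (to_adjoint (a *m v)) - fv v a.
have tadj v a g : dot v a = 0 ->
    adj_raction n K (to_adjoint (a *m v)) g = to_adjoint (((g^-1)%g *m a) *m (v *m g)).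
  move=> va; apply: adj_inj; rewrite adj_actE !val_to_adjoint ?tr_outer ?dot_act //.
  by rewrite !mulmxA.
have to_adjD k p q : \tr p = 0 -> \tr q = 0 ->
    to_adjoint (k *: p + q) = k *: to_adjoint p + to_adjoint q :> adjoint n K.
  move=> p0 q0; apply: adj_inj.
  rewrite adj_valD adj_valZ !val_to_adjoint //.
  by rewrite linearD linearZ /= p0 q0 mulr0 addr0.
have mF : flag_form m.
  split=> [k u v a ua va|k v a b va vb]; rewrite /m ?fvF.1 ?fvF.2 //.
    rewrite mulmxDr -scalemxAr to_adjD ?tr_outer // linearP.
    by rewrite opprD addrACA scalerBr.
  rewrite mulmxDl -scalemxAl to_adjD ?tr_outer // linearP.
  by rewrite opprD addrACA scalerBr.
have phim v a : dot v a = 0 -> phi (m v a) = 0.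
  move=> va; rewrite linearB sK; apply/eqP; rewrite subr_eq0; apply/eqP/adj_inj.
  by rewrite val_to_adjoint ?tr_outer // (phi_flag_vec phiP).
have m0 := invariant_form_eq0 n2 mF.
have sphi : (s \o phi) =1 id.
  apply: linear_ext => // [k p q|v a va] /=; first by rewrite !linearP.
  have phi_to : phi (fv v a) = to_adjoint (a *m v).
    by apply: adj_inj; rewrite (phi_flag_vec phiP) // val_to_adjoint // tr_outer.
  apply/eqP; rewrite phi_to -subr_eq0; apply/eqP; apply: m0 => // g u b ub.
  rewrite /m -tadj // -sg -act_flag_vec // -ractB lift_central // unfold_in.
  by rewrite -/(m u b) phim.
case/eqP: w0; have := sphi w; rewrite /= => <-.
by move: wk; rewrite unfold_in => /eqP ->; rewrite linear0.
Qed.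

End Lift.
End Action.

(** * The dual of the kernel as a cohomology group *)
Lemma linear_form_of (K : fieldType) (V : lmodType K) (f : V -> K^o) :
  linear f -> f \in @linear_form K V.
Proof. by move=> lf; apply/asboolP. Qed.

(** Equality in the quotient module, unfolded to coboundaries. *)
Lemma H1_eq (G : groupType) (K : fieldType) (V : lmodType K) (a : raction G V)
    (f h : Z1 a) :
  \pi_(H1 a)%qT f = \pi_(H1 a)%qT h <-> exists l : V, forall g, f g - h g = a l g - l.
Proof.
have E : (f - h \in @B1 G K V a) = (\pi_(H1 a)%qT f == \pi_(H1 a)%qT h).
  exact: (@Quotient.idealrBE _ (quot_pred (@B1 G K V a))).
split=> [/eqP|[l lE]]; first by rewrite -E => /asboolP[l lE]; exists l => g; rewrite -lE.
by apply/eqP; rewrite -E; apply/asboolP; exists l => g; rewrite -lE.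
Qed.

Lemma pi_H1_linear (G : groupType) (K : fieldType) (V : lmodType K) (a : raction G V) k
    (f h : Z1 a) :
  \pi_(H1 a)%qT (k *: f + h) = k *: (\pi_(H1 a)%qT f : H1 a) + \pi_(H1 a)%qT h.
Proof.
rewrite -[k *: (\pi_(H1 a)%qT f : H1 a)]/(quotmod_scale k _) quotmod_scale_pi.
exact: (raddfD (\pi_(quotmod (@B1 G K V a)))%qT).
Qed.

Lemma bijective_of (A B : Type) (f : A -> B) :
  injective f -> (forall y, exists x, f x = y) -> bijective f.
Proof.
move=> finj fsurj; have [g gK] := choice fsurj.
by exists g => // x; apply: finj.
Qed.

Section CohomologyIso.
Variables (n : nat) (K : fieldType) (Ahat : lmodType K).
Variables (ehat : flag_geometry n K -> set Ahat) (phi : {linear Ahat -> adjoint n K}).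
Hypotheses (n2 : (2 <= n)%N).
Hypothesis ehatU : relatively_universal_cover ehat (@nat_embedding n K).
Hypothesis phiP : projects phi ehat (@nat_embedding n K).
Variable act : raction (SL n K) Ahat.
Hypothesis actP : lifts_action ehat phi act.
Variable s : {linear adjoint n K -> Ahat}.
Hypothesis sK : cancel s phi.
Implicit Types (l : dual (kermod phi)) (g h : SL n K) (t : Ahat) (q : adjoint n K).

Let ehatP : is_embedding ehat. Proof. by case: ehatU. Qed.
Local Notation fv := (flag_vec ehat phi).
Let fvF : flag_form fv. Proof. exact: flag_vec_form ehatP phiP. Qed.
Local Notation A := (adj_raction n K).

Let actphi t g : phi (act t g) = A (phi t) g. Proof. by case: actP. Qed.

Fact kernel_part_subproof t : t - s (phi t) \in kerp phi.
Proof. by rewrite unfold_in linearB sK subrr. Qed.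

Definition kernel_part t : kermod phi := Kermod (kernel_part_subproof t).

Lemma kernel_part_linear : linear kernel_part.
Proof.
move=> k t t'; apply: val_inj.
change (k *: t + t' - s (phi (k *: t + t')) = k *: (t - s (phi t)) + (t' - s (phi t'))).
by rewrite (linearP phi) (linearP s) scalerBr [- (_ + _)]opprD addrACA.
Qed.

Lemma kernel_part_s q : kernel_part (s q) = 0.
Proof. by apply: val_inj; rewrite /= sK subrr. Qed.

Lemma kernel_part_id (w : kermod phi) : kernel_part (kermod_val w) = w.
Proof.
apply: val_inj; rewrite /=; case: w => w /=; rewrite unfold_in => /eqP ->.
by rewrite linear0 subr0.
Qed.

(** The extension of [l] by [0] on the complement [s A] of the kernel. *)
Definition extend l t : K^o := l (kernel_part t).

Lemma extend_linear l : linear (extend l).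
Proof. by move=> k t t'; rewrite /extend kernel_part_linear dual_linear. Qed.

Lemma extend_s l q : extend l (s q) = 0.
Proof.
rewrite /extend kernel_part_s.
by have := dual_linear l (-1) 0 0; rewrite scaler0 addr0 scaleN1r addNr.
Qed.

Fact transgression_subproof l g :
  (fun q => extend l (act (s q) g^-1%g)) \in @linear_form K (adjoint n K).
Proof.
apply: linear_form_of => k q q'.
by rewrite linearP ract_linear extend_linear.
Qed.

Definition transgression_fun l g : dual (adjoint n K) := Dual (transgression_subproof l g).

(** Because the kernel is fixed by the group, the coboundary of [extend l]
    factors through [phi]. *)
Lemma extend_act l g t :
  extend l (act t g^-1%g) = transgression_fun l g (phi t) + extend l t.
Proof.
have lD := extend_linear l.
have fix_ker w : phi w = 0 -> act w g^-1%g = w.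
  by move=> w0; apply: (lift_central n2 ehatU phiP actP); rewrite unfold_in w0.
have tE : t = 1 *: s (phi t) + (t - s (phi t)) by rewrite scale1r addrC subrK.
have h0 : phi (t - s (phi t)) = 0 by rewrite linearB sK subrr.
have e0 : extend l (t - s (phi t)) = extend l t.
  have := lD (-1) (s (phi t)) t; rewrite extend_s scaler0 add0r scaleN1r addrC.
  by [].
by rewrite {1}tE ract_linear lD scale1r (fix_ker _ h0) e0.
Qed.

Fact transgression_cocycle l : transgression_fun l \in cocycle (dual_raction A).
Proof.
apply/asboolP; split=> [|g h]; apply: val_inj; apply: funext => q.
  by rewrite /= invg1 ract1 extend_s.
change (extend l (act (s q) (g * h)^-1%g) =
  extend l (act (s (A q h^-1%g)) g^-1%g) + extend l (act (s q) h^-1%g)).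
by rewrite invgM ractM extend_act actphi sK.
Qed.

Definition transgression l : Z1 (dual_raction A) := MkZ1 (transgression_cocycle l).

Lemma transgression_linear k l l' :
  transgression (k *: l + l') = k *: transgression l + transgression l'.
Proof. by apply: val_inj; apply: funext => g; apply: val_inj; apply: funext. Qed.

(** If the class of [l] is trivial, [extend l - xi \o phi] is an invariant
    linear form on [Ahat], and vanishes on flag vectors. *)
Lemma transgression_eq0 l (xi : dual (adjoint n K)) :
  (forall g, transgression l g = dual_raction A xi g - xi) -> l = 0.
Proof.
move=> lxi; pose mu t : K^o := extend l t - xi (phi t).
have muL : linear mu.
  move=> k t t'; rewrite /mu extend_linear linearP dual_linear.
  by rewrite opprD scalerBr addrACA.
have mu_inv t g : mu (act t g) = mu t.
  have := extend_act l g^-1%g t; rewrite invgK /mu => ->.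
  have -> : transgression_fun l g^-1%g (phi t) = xi (A (phi t) g) - xi (phi t).
    have := congr1 (fun z : dual (adjoint n K) => dual_val z (phi t)) (lxi g^-1%g).
    by rewrite /= invgK.
  by rewrite actphi addrAC [X in X + _ = _]addrAC subrr add0r addrC.
have m0 : forall v a, dot v a = 0 -> mu (fv v a) = 0.
  have mF : flag_form (fun v a => mu (fv v a)).
    by split=> [k u v a ua va|k v a b va vb]; rewrite ?fvF.1 ?fvF.2 // muL.
  apply: (invariant_form_eq0 n2 mF) => g v a va.
  by rewrite -(act_flag_vec ehatU phiP actP) // mu_inv.
have mu0 : mu =1 (fun=> 0).
  apply: (linear_ext ehatU phiP) => // k t t'.
  by rewrite scaler0 addr0.
have xi0 : xi 0 = 0.
  by have := dual_linear xi (-1) 0 0; rewrite scaler0 addr0 scaleN1r addNr.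
apply: val_inj; apply: funext => w; change (l w = 0).
have := mu0 (kermod_val w); rewrite /mu /extend kernel_part_id.
have -> : phi (kermod_val w) = 0.
  by case: w => w /=; rewrite unfold_in => /eqP.
by rewrite xi0 subr0.
Qed.

(** The form of the cocycle extends to a linear form [mu] on [Ahat] whose
    coboundary is [f]; its restriction to the kernel is the required [l], and
    [xi] is its restriction to the complement [s A]. *)
Lemma transgression_surjective (f : Z1 (dual_raction A)) :
  exists l (xi : dual (adjoint n K)),
    forall g, f g - transgression l g = dual_raction A xi g - xi.
Proof.
have fM g h q : f (g * h)%g q = f g (A q h^-1%g) + f h q.
  case: f => f /= /asboolP[_ fM].
  by rewrite fM.
(* A linear projection of matrices onto traceless ones. *)
pose pr (m : 'M[K]_n.+1) : adjoint n K := to_adjoint (m - \tr m *: delta_mx 0 0).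
have tr_e00 : \tr (delta_mx 0 0 : 'M[K]_n.+1) = 1.
  by rewrite -(mul_delta_mx (0 : 'I_1)) mxtrace_mulC mul_delta_mx /mxtrace big_ord1 mxE !eqxx.
have tr_pr (m : 'M[K]_n.+1) : \tr (m - \tr m *: delta_mx 0 0) = 0.
  by rewrite linearB /= mxtraceZ tr_e00 mulr1 subrr.
have prE m : \tr m = 0 -> adj_val (pr m) = m.
  by move=> m0; rewrite val_to_adjoint ?tr_pr // m0 scale0r subr0.
pose c g m : K := f g^-1%g (pr m).
have cP : scalar_cocycle c.
  split=> [g k m m'|g h m m0].
    rewrite /c; have -> : pr (k *: m + m') = k *: pr m + pr m'.
      apply: adj_inj; rewrite adj_valD adj_valZ !val_to_adjoint ?tr_pr //.
      rewrite linearP /= scalerDl scalerBr scalerA opprD addrACA.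
      by [].
    by rewrite dual_linear.
  rewrite /c invgM fM invgK; congr (f _ _ + _).
  apply: adj_inj; rewrite adj_actE !prE // ?tr_conj_mx //.
have [m [mF mH]] := cocycle_form n2 cP.
have [mu muE] := universal_form n2 ehatU phiP mF.
have mu_act t g : mu (act t g) = mu t + f g^-1%g (phi t).
  apply: (linear_ext ehatU phiP (f := fun t => mu (act t g))
     (f' := fun t => mu t + f g^-1%g (phi t) : K^o)) => [k p q|k p q|v a va].
  - by rewrite ract_linear linearP.
  - by rewrite !linearP dual_linear scalerDr addrACA.
  rewrite (act_flag_vec ehatU phiP actP) // !muE ?dot_act // mH //.
  congr (_ + f _ _); apply: adj_inj.
  by rewrite prE ?tr_outer // (phi_flag_vec phiP).
have lL : linear (fun w : kermod phi => mu (kermod_val w)).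
  move=> k w w'; change (mu (k *: kermod_val w + kermod_val w') =
    k *: mu (kermod_val w) + mu (kermod_val w')).
  exact: linearP.
have xiL : linear (fun q => mu (s q)) by move=> k q q'; rewrite !linearP.
exists (Dual (linear_form_of lL)), (Dual (linear_form_of xiL)) => g.
apply: val_inj; apply: funext => q.
change (f g q - mu (act (s q) g^-1%g - s (phi (act (s q) g^-1%g))) =
  mu (s (A q g^-1%g)) - mu (s q)).
rewrite actphi sK linearB /= mu_act invgK sK.
by rewrite opprB addrCA opprD [X in _ + X = _]addrCA subrr addr0.
Qed.

Theorem dual_kernel_iso : lmod_isomorphic (dual (kermod phi)) (H1 (dual_raction A)).
Proof.
pose F l : H1 (dual_raction A) := \pi_(H1 (dual_raction A))%qT (transgression l).
have FL : linear F by move=> k l l'; rewrite /F transgression_linear pi_H1_linear.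
have [f fE] := linear_ex FL; exists f; apply: bijective_of => [l l'|y].
  rewrite !fE => /H1_eq[xi h]; apply/eqP; rewrite -subr_eq0; apply/eqP.
  apply: (@transgression_eq0 _ xi) => g; rewrite -h.
  by rewrite -[l - l']addrC -scaleN1r transgression_linear scaleN1r addrC.
elim/quotW: y => y.
have [l [xi h]] := transgression_surjective y; exists l; rewrite fE; symmetry.
by apply/H1_eq; exists xi.
Qed.

End CohomologyIso.

Theorem lemma1p1 (n : nat) (K : fieldType) (Ahat : lmodType K)
    (ehat : flag_geometry n K -> set Ahat)
    (phi : {linear Ahat -> adjoint n K}) :
  (2 <= n)%N ->
  relatively_universal_cover ehat (@nat_embedding n K) ->
  projects phi ehat (@nat_embedding n K) ->
  [/\ exists act : raction (SL n K) Ahat, lifts_action ehat phi act,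
      forall act : raction (SL n K) Ahat, lifts_action ehat phi act ->
        [/\ is_extension act (adj_raction n K) (kerp phi) phi,
            central act (kerp phi)
          & non_split act (kerp phi) phi]
    & lmod_isomorphic (dual (kermod phi))
                      (H1 (dual_raction (adj_raction n K)))].
Proof.
move=> n2 ehatU phiP; have [act actP] := lift_exists n2 ehatU phiP.
split; first by exists act.
  move=> act' actP'; split.
  - exact: lift_extension actP'.
  - exact: lift_central actP'.
  exact: lift_nonsplit actP'.
have [s sK] := linear_section phiP.
exact: (dual_kernel_iso n2 ehatU phiP actP sK).
Qed.
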